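(* Let $n$ be a positive integer and $r$ a nonzero integer such that $r\mid 4n$, $-n<r\leq n$ and $|r|\neq 1,4$, and suppose that $d=n^2+r$ is square-free with $d\equiv 1\pmod 8$. If $h(d)=3$, then $$\sum_{\substack{ |t|<\sqrt{d}\\ t^2\equiv d \pmod 4}}\sigma\left(\frac{d-t^2}{4}\right)=\frac{2n^3(r^2+1)+n(3r^3+170r^2+3r)}{8r^2}.$$ Conversely, if $h(d)$ is odd, $d\neq 33$, and $$\sum_{\substack{ |t|<\sqrt{d}\\ t^2\equiv d \pmod 4}}\sigma\left(\frac{d-t^2}{4}\right)=\frac{2n^3(r^2+1)+n(3r^3+170r^2+3r)}{8r^2},$$ then $h(d)=3$.
   Context: $h(d)$ denotes the class number of the real quadratic field $\mathbb{Q}(\sqrt{d})$. For a positive integer $m$, $\sigma(m)$ denotes the sum of the positive divisors of $m$. The sum runs over all integers $t$ (positive, negative or zero) satisfying the stated conditions. *)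

(* Defs.v *)
From mathcomp Require Import all_boot all_order all_algebra all_field.
From mathcomp Require Import finmap.
From mathcomp Require Import boolp classical_sets functions cardinality fsbigop.

Set Implicit Arguments.
Unset Strict Implicit.
Unset Printing Implicit Defensive.

Import Order.TTheory GRing.Theory Num.Theory.

Local Open Scope classical_set_scope.
Local Open Scope ring_scope.

(* Number fields are represented by their underlying subsets of algC. *)

(* For d > 0, sqrtC d%:~R is the nonnegative square root of d. *)
Definition quadratic_field (d : int) : set algC :=
  [set z | exists a b : rat, z = ratr a + ratr b * sqrtC d%:~R].

Definition ring_of_integers (K : set algC) : set algC :=
  [set z | K z /\ z \in Aint].

Section IdealClasses.

Variable O : set algC.

Definition is_ideal (I : set algC) : Prop :=
  [/\ I `<=` O, I 0,
      (forall x y, I x -> I y -> I (x + y)) &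
      (forall a x, O a -> I x -> I (a * x))].

Definition nonzero_ideals : set (set algC) :=
  [set I | is_ideal I /\ exists2 x, I x & x != 0].

Definition ideal_equiv (I J : set algC) : Prop :=
  exists a b : algC, [/\ O a, O b, a != 0, b != 0 &
    [set a * x | x in I] = [set b * x | x in J]].

Definition ideal_class (I : set algC) : set (set algC) :=
  [set J | nonzero_ideals J /\ ideal_equiv I J].

Definition ideal_classes : set (set (set algC)) :=
  [set ideal_class I | I in nonzero_ideals].

End IdealClasses.

(* fset_set sends an infinite set to the empty one; for a number field K the
   set of ideal classes is finite, so this is its actual cardinality. *)
Definition class_number (K : set algC) : nat :=
  #|` fset_set (ideal_classes (ring_of_integers K)) |%fset.

Definition h (d : int) : nat := class_number (quadratic_field d).

Definition sigma (m : nat) : nat := (\sum_(k <- divisors m) k)%N.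

Definition squarefree (d : int) : Prop :=
  forall k : int, (k ^+ 2 %| d)%Z -> `|k| = 1.

(* When t ^ 2 = d [mod 4] and |t| < sqrt d, the quotient (d - t ^ 2) / 4 is
   exact and nonnegative, so the passage to nat through `|_|%N loses nothing. *)
Definition sigma_sum (d : int) : rat :=
  \sum_(t \in [set t : int |
                `|t%:~R| < sqrtC d%:~R :> algC /\ (t ^+ 2 = d %[mod 4])%Z])
     ((sigma `|((d - t ^+ 2) %/ 4)%Z|%N)%:R : rat).

(* Main.v *)
(* By definition the sigma sum is the sum of a over all integer triples (a, b, c)
   with a, c > 0 and b^2 + 4ac = d.  Such a triple is a quadratic irrational
   w = (b + sqrt d)/(2a) with w > 0 > w', and represents the ideal class of
   Z a + Z (b + sqrt d)/2.  Two triples represent the same class exactly when they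
   are exchanged by the slow continued fraction map (w -> w - 1 or w/(1 - w))
   and by w -> 1/w, so the sum splits over ideal classes into sums over cycles,
   and every class contributes a positive amount.

   The hypotheses force n even, r odd and r | n.  The cycles of the trivial class
   and of the class of a prime P above 2 can then be written down; they show
   that 1, P and its conjugate P' are in three different classes unless d = 33
   (h = 1) or d = 105 (h = 2), and that the right-hand side is the contribution
   S(1) + S(P) + S(P').  Hence the formula holds if and only if there is no
   further class. *)
Require Import Defs.
From mathcomp Require Import all_boot all_order all_algebra all_field.
From mathcomp Require Import finmap.
From mathcomp Require Import boolp classical_sets functions cardinality fsbigop.
From mathcomp Require Import zify ring.
Import Order.TTheory GRing.Theory Num.Theory.
Local Open Scope ring_scope.

(** Ideal classes are taken in the wide sense: a multiplier of negative norm amounts to a base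
    change of determinant -1, and this is what [swap] records. A full orbit is thus a cycle of
    [step] together with its image under [swap]. Since [swap] exchanges [a] and [c], summing [a]
    over the orbit is summing [a + c] over the cycle, provided that the cycle and its image are
    disjoint. The class of P' costs no computation: [flip] turns [step] into its inverse, so the
    orbit of P' mirrors that of P and has the same sum, whence the factor 2. The obstacle is that
    the lengths of the cycles depend on n and r. The cycles consist, however, of a fixed number of
    runs of equal steps. Along a run the entries are polynomials in the position, so its sum is a
    cubic polynomial in its length, and concavity reduces positivity to the end of the run. *)

(* (a, b, c) encodes the form a x^2 + b x y - c y^2; note the sign of c. *)
Definition simple (d : int) (w : int * int * int) : bool :=
  let: (a, b, c) := w in [&& 0 < a, 0 < c & b ^+ 2 + 4 * a * c == d].

(* In terms of w = (b + sqrt d)/(2a): w - 1 if w > 1, and w/(1 - w) if w < 1. *)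
Definition step (w : int * int * int) : int * int * int :=
  let: (a, b, c) := w in
  if 0 < c + b - a then (a, b - 2 * a, c + b - a) else (a - b - c, b + 2 * c, c).

(* w -> 1/w *)
Definition swap (w : int * int * int) : int * int * int :=
  let: (a, b, c) := w in (c, - b, a).

(* w -> - w', that is, conjugation of ideals *)
Definition flip (w : int * int * int) : int * int * int :=
  let: (a, b, c) := w in (a, - b, c).

(** * The slow continued fraction map and substitutions of determinant one *)

Lemma simpleP d a b c :
  reflect [/\ 0 < a, 0 < c & b ^+ 2 + 4 * a * c = d] (simple d (a, b, c)).
Proof. by apply: (iffP and3P) => -[? ? /eqP]. Qed.

Lemma swapK : involutive swap.
Proof. by move=> [[a b] c]; rewrite /swap opprK. Qed.

Lemma flipK : involutive flip.
Proof. by move=> [[a b] c]; rewrite /flip opprK. Qed.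

Lemma swap_simple d w : simple d w -> simple d (swap w).
Proof.
by case: w => [[a b] c] /simpleP[? ? <-]; apply/simpleP; split=> //; ring.
Qed.

Lemma flip_simple d w : simple d w -> simple d (flip w).
Proof.
by case: w => [[a b] c] /simpleP[? ? <-]; apply/simpleP; split=> //; ring.
Qed.

Section Steps.

Variable d : int.
Hypothesis d_nonsquare : forall x : int, x ^+ 2 != d.

(** [a - b - c] is the value of the form at (1, -1), and a form of nonsquare discriminant has no
    nontrivial zero. Hence the test in [step] never meets a tie. *)
Lemma simple_neq a b c : simple d (a, b, c) -> c + b - a != 0.
Proof.
move=> /simpleP[a0 c0 dE]; apply/eqP => ab.
have /eqP[] := d_nonsquare (b + 2 * c); rewrite -dE.
have -> : a = b + c by lia.
ring.
Qed.

Lemma step_simple w : simple d w -> simple d (step w).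
Proof.
case: w => [[a b] c] w_simple; have := simple_neq _ _ _ w_simple.
move: w_simple => /simpleP[a0 c0 <-] ne0; rewrite /step.
by case: ifP => cab; apply/simpleP; split=> //; lia || ring.
Qed.

(** [swap] exchanges the two branches; the absence of ties makes the strict test symmetric. *)
Lemma step_swap w : simple d w -> step (swap w) = swap (step w).
Proof.
case: w => [[a b] c] w_simple; have := simple_neq _ _ _ w_simple.
move=> ne0; rewrite /step /swap.
by case: ifP => h1; case: ifP => h2; try lia; congr (_, _, _); ring.
Qed.

(** Conjugation turns [step] into its inverse; injectivity of the iterates follows from this. *)
Lemma step_flip_step w : simple d w -> step (flip (step w)) = flip w.
Proof.
case: w => [[a b] c] /simpleP[a0 c0 _]; rewrite /step /flip.
by case: ifP => h1; case: ifP => h2; try lia; congr (_, _, _); ring.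
Qed.

Lemma iter_step_simple k w : simple d w -> simple d (iter k step w).
Proof. by move=> ?; elim: k => //= k; apply: step_simple. Qed.

Lemma iter_step_swap k w : simple d w -> iter k step (swap w) = swap (iter k step w).
Proof.
move=> ?; elim: k => //= k ->; rewrite step_swap //; exact: iter_step_simple.
Qed.

Lemma iter_step_flip k w :
  simple d w -> iter k step (flip (iter k step w)) = flip w.
Proof.
move=> w_simple; elim: k => //= k IH.
by rewrite -iterS iterSr step_flip_step ?IH //; apply: iter_step_simple.
Qed.

Lemma iter_step_inj k w1 w2 : simple d w1 -> simple d w2 ->
  iter k step w1 = iter k step w2 -> w1 = w2.
Proof.
move=> s1 s2 e; apply: (can_inj flipK).
by rewrite -(iter_step_flip k) // e iter_step_flip.
Qed.

(** Substitution of [p x + s y] and [q x + t y] for the variables of the form. The last entry is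
    minus the value at [(s, t)], by the sign convention for [c]. *)
Definition act (p q s t : int) (w : int * int * int) : int * int * int :=
  let: (a, b, c) := w in
  (a * p ^+ 2 + b * p * q - c * q ^+ 2,
   2 * a * p * s + b * (p * t + q * s) - 2 * c * q * t,
   c * t ^+ 2 - a * s ^+ 2 - b * s * t).

Lemma act1 w : act 1 0 0 1 w = w.
Proof. by case: w => [[a b] c]; rewrite /act; congr (_, _, _); ring. Qed.

(** Euclid's algorithm on rows. If [p > s] and [t > q], then [(s + 1) (q + 1) <= p t = 1 + q s]
    forces [q = s = 0]; the opposite crossing makes the determinant negative. *)
Lemma row_dominance (p q s t : int) :
  0 <= p -> 0 <= q -> 0 <= s -> 0 <= t -> p * t - q * s = 1 ->
  [\/ [/\ p = 1, q = 0, s = 0 & t = 1], p <= s /\ q <= t | s <= p /\ t <= q].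
Proof.
move=> p0 q0 s0 t0 D.
have [ps|sp] := lerP p s; have [qt|tq] := lerP q t.
- by constructor 2.
- have [/eqP sp|sp] := eqVneq p s; first by constructor 3; split; lia.
  nia.
- have [/eqP tq|tq] := eqVneq q t; first by constructor 3; split; lia.
  constructor 1.
  have : (s + 1) * (q + 1) <= p * t by apply: ler_pM; lia.
  have s_0 : s = 0 by nia.
  have q_0 : q = 0 by nia.
  by subst s q => _; split=> //; nia.
- by constructor 3; split; lia.
Qed.

Lemma det1_gt0 (p q s t : int) :
  0 <= p -> 0 <= q -> 0 <= s -> 0 <= t -> p * t - q * s = 1 -> 0 < p /\ 0 < t.
Proof.
move=> p0 q0 s0 t0 D; have qs0 : 0 <= q * s by rewrite mulr_ge0.
by rewrite !lt_def p0 t0 !andbT; split; apply/eqP => e; move: D; rewrite e; lia.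
Qed.

(** The quantity bounded here is minus the one that [step] tests after the substitution. Were it
    positive, the left side of [key] would be nonnegative and the right side nonpositive, so both
    vanish; then [t = q], and the determinant [(p - s) t] is not positive. *)
Lemma row_difference_sign (a b c p q s t : int) :
    0 < a -> 0 < c -> 0 <= p -> 0 <= q -> 0 <= s -> 0 <= t ->
    p * t - q * s = 1 -> p <= s -> q <= t ->
    0 < c * t ^+ 2 - a * s ^+ 2 - b * s * t ->
  a * (s - p) ^+ 2 + b * (s - p) * (t - q) - c * (t - q) ^+ 2 <= 0.
Proof.
move=> a0 c0 p0 q0 s0 t0 D ps qt Y_gt0; rewrite leNgt; apply/negP => X_gt0.
have [p_gt0 t_gt0] := det1_gt0 _ _ _ _ p0 q0 s0 t0 D.
set Y := (X in 0 < X) in Y_gt0; set X := (X in 0 < X) in X_gt0.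
have key : X * (s * t) + Y * ((s - p) * (t - q))
    = - ((p * t - q * s) * (a * s * (s - p) + c * t * (t - q))).
  by rewrite /X /Y; ring.
have e1 : 0 <= X * (s * t) by apply: mulr_ge0; [exact: ltW | exact: mulr_ge0].
have e2 : 0 <= Y * ((s - p) * (t - q)).
  by apply: mulr_ge0; [exact: ltW | rewrite mulr_ge0 ?subr_ge0].
have e3 : 0 <= a * s * (s - p) by rewrite !mulr_ge0 ?subr_ge0 // ltW.
have e4 : 0 <= c * t * (t - q) by rewrite !mulr_ge0 ?subr_ge0 // ltW.
have /eqP : c * t * (t - q) = 0.
  move: (X * _) (Y * _) (a * s * _) (c * t * _) key e1 e2 e3 e4 => x y z w.
  by rewrite D mul1r; lia.
rewrite !mulf_eq0 gt_eqF // gt_eqF //= subr_eq0 => /eqP tq.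
have : (p - s) * t <= 0 by rewrite mulr_le0_ge0 // subr_le0.
by rewrite mulrBl [s * t]mulrC {2}tq D.
Qed.

(** Induction on the sum of the entries: by the sign just computed, [step] performs the row
    subtraction offered by [row_dominance], until the identity matrix is left. *)
Lemma step_act_nonneg w (p q s t : int) :
    simple d w -> 0 <= p -> 0 <= q -> 0 <= s -> 0 <= t -> p * t - q * s = 1 ->
    simple d (act p q s t w) ->
  exists k, iter k step (act p q s t w) = w.
Proof.
case: w => [[a b] c] w_simple.
have [a0 c0 dE] := simpleP _ _ _ _ w_simple.
move=> p0 q0 s0 t0.
have [N] : exists N : nat, p + q + s + t <= N%:Z.
  by exists `|(p + q + s + t)%R|%N; lia.
elim: N p q s t p0 q0 s0 t0 => [|N IH] p q s t p0 q0 s0 t0 le_N D act_simple.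
  by have [] := det1_gt0 _ _ _ _ p0 q0 s0 t0 D; lia.
have := simple_neq _ _ _ act_simple.
have [A0 C0 _] := simpleP _ _ _ _ act_simple.
have [p_gt0 t_gt0] := det1_gt0 _ _ _ _ p0 q0 s0 t0 D.
have [[-> -> -> ->] _|[ps qt] ne0|[sp tq] ne0] := row_dominance _ _ _ _ p0 q0 s0 t0 D.
- by exists 0%N; rewrite act1.
- have stepE : step (act p q s t (a, b, c)) = act p q (s - p) (t - q) (a, b, c).
    have := row_difference_sign a b c p q s t a0 c0 p0 q0 s0 t0 D ps qt C0.
    rewrite /step {1}/act => le0; rewrite ifT; first by congr (_, _, _); ring.
    rewrite lt_neqAle eq_sym ne0 /= -oppr_le0; apply: le_trans le0.
    by rewrite le_eqVlt; apply/orP; left; apply/eqP; ring.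
  have s'0 : 0 <= s - p by rewrite subr_ge0.
  have t'0 : 0 <= t - q by rewrite subr_ge0.
  have le_N' : p + q + (s - p) + (t - q) <= N%:Z.
    by move: le_N p_gt0 q0; clear; lia.
  have D' : p * (t - q) - q * (s - p) = 1 by rewrite -D; ring.
  have [|k kE] := IH _ _ _ _ p0 q0 s'0 t'0 le_N' D'.
    by rewrite -stepE; apply: step_simple.
  by exists k.+1; rewrite iterSr stepE.
(* The previous case for the form [(c, - b, a)], with rows and columns exchanged. *)
- have stepE : step (act p q s t (a, b, c)) = act (p - s) (q - t) s t (a, b, c).
    have D' : t * p - s * q = 1 by rewrite -D; ring.
    have A0' : 0 < a * p ^+ 2 - c * q ^+ 2 - (- b) * q * p.
      by move: A0; congr (0 < _); ring.
    have := row_difference_sign _ _ _ _ _ _ _ c0 a0 t0 s0 q0 p0 D' tq sp A0'.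
    rewrite /step {1}/act => le0; rewrite ifF; first by congr (_, _, _); ring.
    apply/negbTE; rewrite -leNgt; apply: le_trans le0.
    by rewrite le_eqVlt; apply/orP; left; apply/eqP; ring.
  have p'0 : 0 <= p - s by rewrite subr_ge0.
  have q'0 : 0 <= q - t by rewrite subr_ge0.
  have le_N' : p - s + (q - t) + s + t <= N%:Z.
    by move: le_N t_gt0 s0; clear; lia.
  have D' : (p - s) * t - (q - t) * s = 1 by rewrite -D; ring.
  have [|k kE] := IH _ _ _ _ p'0 q'0 s0 t0 le_N' D'.
    by rewrite -stepE; apply: step_simple.
  by exists k.+1; rewrite iterSr stepE.
Qed.

Lemma act_comp p q s t p' q' s' t' w :
  act p' q' s' t' (act p q s t w)
    = act (p' * p + q' * s) (p' * q + q' * t) (s' * p + t' * s) (s' * q + t' * t) w.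
Proof. by case: w => [[a b] c]; rewrite /act; congr (_, _, _); ring. Qed.

Lemma act_opp p q s t w : act (- p) (- q) (- s) (- t) w = act p q s t w.
Proof. by case: w => [[a b] c]; rewrite /act; congr (_, _, _); ring. Qed.

(* [key] below shows that all entries of (p, q; s, t) or of its inverse have the
   same sign. *)
Lemma step_act w (p q s t : int) :
    simple d w -> p * t - q * s = 1 -> simple d (act p q s t w) ->
  exists k, iter k step (act p q s t w) = w \/ iter k step w = act p q s t w.
Proof.
wlog p_gt0 : p q s t / 0 < p.
  move=> wl w_simple D act_simple.
  have [p_gt0|p_lt0|p0] := ltrgtP 0 p; first exact: wl.
    rewrite -act_opp; apply: wl => //; rewrite ?act_opp //; first lia.
    by rewrite -D; ring.
  case: w w_simple act_simple {wl} => [[a b] c] /simpleP[_ c0 _] /simpleP[A0 _ _].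
  by subst p; nia.
move=> w_simple D act_simple; case: w w_simple act_simple => [[a b] c] w_simple act_simple.
have [a0 c0 dE] := simpleP _ _ _ _ w_simple.
have [A0 C0 _] := simpleP _ _ _ _ act_simple.
have key : (a * p ^+ 2 + b * p * q - c * q ^+ 2) * (s * t)
      + (c * t ^+ 2 - a * s ^+ 2 - b * s * t) * (p * q)
      = a * (p * s) + c * (q * t).
  by rewrite -[RHS]mul1r -D; ring.
have t_gt0 : 0 < t.
  rewrite ltNge; apply/negP => t_le0.
  have t_lt0 : t < 0 by rewrite lt_neqAle t_le0 andbT; apply/eqP => t0; subst t; nia.
  have qs : q * s < 0.
    have : p * t < 0 by rewrite pmulr_rlt0.
    by move: D; clear; lia.
  have sum_lt (x y z w : int) :
    x + y = z + w -> 0 < x -> 0 < y -> z < 0 -> w < 0 -> False by clear; lia.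
  have [q_gt0|q_lt0|q0] := ltrgtP 0 q.
  - have s_lt0 : s < 0 by rewrite -(pmulr_rlt0 _ q_gt0).
    apply: (sum_lt _ _ _ _ key); first by rewrite mulr_gt0 // nmulr_rgt0.
    + by rewrite !mulr_gt0.
    + by rewrite !pmulr_rlt0.
    + by rewrite !pmulr_rlt0.
  - have s_gt0 : 0 < s by rewrite -(nmulr_rlt0 _ q_lt0).
    apply: (sum_lt _ _ _ _ (esym key)); first by rewrite !mulr_gt0.
    + by rewrite mulr_gt0 // nmulr_rgt0.
    + by rewrite !pmulr_rlt0.
    + by rewrite !pmulr_rlt0.
  - by rewrite -q0 mul0r ltxx in qs.
have qs : 0 <= q * s by nia.
have [|] : (0 <= q /\ 0 <= s) \/ (q <= 0 /\ s <= 0) by nia.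
  case=> q0 s0; have [k kE] := step_act_nonneg _ _ _ _ _ w_simple (ltW p_gt0) q0 s0 (ltW t_gt0) D act_simple.
  by exists k; left.
case=> q0 s0.
(* The inverse matrix is nonnegative, so the two forms exchange roles. *)
have wE : act t (- q) (- s) p (act p q s t (a, b, c)) = (a, b, c).
  rewrite act_comp -[RHS]act1 -D; congr (act _ _ _ _ _); ring.
have q'0 : 0 <= - q by rewrite oppr_ge0.
have s'0 : 0 <= - s by rewrite oppr_ge0.
have D' : t * p - - q * - s = 1 by rewrite -D; ring.
have [|k kE] := step_act_nonneg _ _ _ _ _ act_simple (ltW t_gt0) q'0 s'0 (ltW p_gt0) D'.
  by rewrite wE.
by exists k; right; rewrite -kE wE.
Qed.

End Steps.

(** [swap w2] accounts for determinant -1: such a base change yields the negated triple of [w2], and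
    exchanging the two basis vectors turns this into [swap w2] with determinant 1. *)
Definition equivalent (w w2 : int * int * int) : Prop :=
  exists p q s t : int, p * t - q * s = 1 /\
    (act p q s t w = w2 \/ act p q s t w = swap w2).

Lemma act_flip p q s t w : act p (- q) (- s) t (flip w) = flip (act p q s t w).
Proof. by case: w => [[a b] c]; rewrite /act /flip; congr (_, _, _); ring. Qed.

Lemma flip_swap w : flip (swap w) = swap (flip w).
Proof. by case: w => [[a b] c]. Qed.

Lemma equivalent_flip w w2 : equivalent w w2 -> equivalent (flip w) (flip w2).
Proof.
move=> [p [q [s [t [D H]]]]]; exists p, (- q), (- s), t; split; first by rewrite -D; ring.
by rewrite !act_flip -flip_swap; case: H => ->; [left | right].
Qed.

(** * Sums along runs of steps *)

(** The joint contribution of a form and its [swap] to the sum of first entries. *)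
Definition weight (w : int * int * int) : rat := (w.1.1 + w.2)%:Q.

(** The final form [w'] is neither tested nor counted, so that chains concatenate. *)
Definition chain (P : pred (int * int * int)) (w w' : int * int * int) (S : rat) :=
  exists k, [/\ iter k step w = w', all P (traject step w k) &
                \sum_(x <- traject step w k) weight x = S].

Lemma chain_trans P w1 w2 w3 S1 S2 :
  chain P w1 w2 S1 -> chain P w2 w3 S2 -> chain P w1 w3 (S1 + S2).
Proof.
move=> [k [<- P1 <-]] [l [<- P2 <-]]; exists (k + l)%N.
by rewrite trajectD all_cat P1 P2 big_cat addnC iterD.
Qed.

Lemma chain_eq P w w1 w2 S1 S2 :
  chain P w w1 S1 -> w1 = w2 -> S1 = S2 -> chain P w w2 S2.
Proof. by move=> h <- <-. Qed.

Lemma chain_sub (P Q : pred (int * int * int)) w w' S :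
  (forall x, P x -> Q x) -> chain P w w' S -> chain Q w w' S.
Proof.
by move=> PQ [k [? Pk ?]]; exists k; split=> //; apply: sub_all Pk.
Qed.

(** Closed form of the sum of [a + c + b j - a j^2] over [0 <= j < q]. *)
Definition run_sum (a b c q : int) : rat :=
  q%:Q * (a%:Q + c%:Q) + b%:Q * q%:Q * (q%:Q - 1) / 2
    - a%:Q * q%:Q * (q%:Q - 1) * (2 * q%:Q - 1) / 6.

(** Concavity in [j]: only the end of a run has to be checked for positivity. *)
Lemma concave_gt0 (a b c j q : int) :
  0 <= a -> 0 < c -> 0 <= j -> j <= q -> 0 < c + b * q - a * q ^+ 2 ->
  0 < c + b * j - a * j ^+ 2.
Proof.
move=> a0 c0 j0 jq q_gt0; have [q0|q0|q0] := ltrgtP 0 q; last 2 first.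
- by move: (le_trans j0 jq); rewrite leNgt q0.
- have -> : j = 0 by apply/eqP; rewrite eq_le j0 andbT q0.
  by rewrite !mulr0 subr0 addr0.
rewrite -(pmulr_rgt0 _ q0).
have -> : q * (c + b * j - a * j ^+ 2)
    = (q - j) * c + j * (c + b * q - a * q ^+ 2) + a * j * q * (q - j) by ring.
have [->|jq'] := eqVneq j q; first by rewrite subrr mul0r add0r mulr0 addr0 mulr_gt0.
have qj : 0 < q - j by rewrite subr_gt0 lt_neqAle jq' jq.
by rewrite -addrA ltr_pwDl ?mulr_gt0 // addr_ge0 // !mulr_ge0 // ltW.
Qed.

Lemma iter_step_right (a b c : int) (q : nat) :
  0 < a -> 0 < c -> 0 < c + b * q%:Z - a * q%:Z ^+ 2 ->
  iter q step (a, b, c) = (a, b - 2 * a * q%:Z, c + b * q%:Z - a * q%:Z ^+ 2).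
Proof.
move=> a0 c0; elim: q => [_|q IH q_gt0].
  by rewrite /=; congr (_, _, _); ring.
rewrite iterS IH; last first.
  by apply: concave_gt0 q_gt0 => //; rewrite ?lez_nat // ltW.
rewrite /step ifT; first by rewrite -[q.+1]addn1 PoszD; congr (_, _, _); ring.
by move: q_gt0; congr (0 < _); rewrite -[q.+1]addn1 PoszD; ring.
Qed.

Lemma sum_run_right (a b c : int) (q : nat) :
  \sum_(j < q) weight (a, b - 2 * a * j%:Z, c + b * j%:Z - a * j%:Z ^+ 2)
    = run_sum a b c q%:Z.
Proof.
elim: q => [|q IH]; first by rewrite big_ord0 /run_sum; field.
rewrite big_ord_recr IH /run_sum /weight /=.
by rewrite -[q.+1]addn1 PoszD !(rmorphD, rmorphB, rmorphM, rmorphXn) /=; field.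
Qed.

Lemma traject_right (a b c : int) (q : nat) :
  0 < a -> 0 < c -> 0 < c + b * q%:Z - a * q%:Z ^+ 2 ->
  traject step (a, b, c) q =
    [seq (a, b - 2 * a * j%:Z, c + b * j%:Z - a * j%:Z ^+ 2) | j <- iota 0 q].
Proof.
move=> a0 c0 q_gt0; apply: (@eq_from_nth _ (a, b, c)).
  by rewrite size_traject size_map size_iota.
move=> j; rewrite size_traject => jq.
rewrite nth_traject // (nth_map 0%N) ?size_iota // nth_iota // add0n.
rewrite iter_step_right //; apply: concave_gt0 q_gt0 => //; first exact: ltW.
by rewrite lez_nat ltnW.
Qed.

Lemma chain_right (P : pred (int * int * int)) (a b c q : int) :
    0 < a -> 0 < c -> 0 <= q -> 0 < c + b * q - a * q ^+ 2 ->
    (forall j : int, 0 <= j -> j + 1 <= q -> P (a, b - 2 * a * j, c + b * j - a * j ^+ 2)) ->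
  chain P (a, b, c) (a, b - 2 * a * q, c + b * q - a * q ^+ 2) (run_sum a b c q).
Proof.
move=> a0 c0; case: q => // q _ q_gt0 Pj; exists q.
rewrite traject_right // iter_step_right //; split=> //.
  apply/allP => x /mapP[j]; rewrite mem_iota add0n => jq ->.
  by apply: Pj => //; lia.
by rewrite big_map -sum_run_right -[q in iota 0 q]subn0 big_mkord.
Qed.

Lemma chain_swap d P w w' S : (forall x, x ^+ 2 != d) -> simple d w ->
  chain (P \o swap) (swap w) (swap w') S -> chain P w w' S.
Proof.
move=> nsq w_simple [k [kE Pk Sk]]; exists k.
have trE : traject step w k = [seq swap x | x <- traject step (swap w) k].
  apply: (@eq_from_nth _ w) => [|j]; rewrite ?size_map ?size_traject // => jk.
  rewrite (nth_map (swap w)) ?size_traject // !nth_traject //.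
  by rewrite (iter_step_swap d) // swapK.
split.
- by apply: (can_inj swapK); rewrite -kE (iter_step_swap d).
- by rewrite trE all_map.
rewrite trE big_map -Sk; apply: eq_bigr => -[[a b] c] _.
by rewrite /weight /= addrC.
Qed.

(** A left run is a right run of the swapped form, hence the arguments [c], [- b], [a] of
    [run_sum]. *)
Lemma chain_left d (P : pred (int * int * int)) (a b c q : int) :
    (forall x, x ^+ 2 != d) -> simple d (a, b, c) ->
    0 <= q -> 0 < a - b * q - c * q ^+ 2 ->
    (forall j : int, 0 <= j -> j + 1 <= q -> P (a - b * j - c * j ^+ 2, b + 2 * c * j, c)) ->
  chain P (a, b, c) (a - b * q - c * q ^+ 2, b + 2 * c * q, c) (run_sum c (- b) a q).
Proof.
move=> nsq w_simple q0 q_gt0 Pj; apply: (chain_swap d) => //.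
have [a0 c0 _] := simpleP _ _ _ _ w_simple.
apply: (@chain_eq _ _ (c, - b - 2 * c * q, a + - b * q - c * q ^+ 2)) => //.
  apply: chain_right => //; first by rewrite mulNr.
  move=> j j0 jq; have := Pj j j0 jq.
  by rewrite /comp /swap mulNr opprB [2 * c * j - _]addrC opprK.
by rewrite /swap mulNr opprD.
Qed.

(** * The cycles of the trivial class and of a prime above 2 *)

Definition inner (M : int) (x : int * int * int) : bool := - M < x.1.2 < M.

(** [b] is monotone along a run, so bounds at its two ends suffice. The bound at the far end is not
    strict because the final form is not tested. *)
Lemma chain_right_inner M (a b c q b' c' : int) :
    0 < a -> 0 < c -> 0 <= q -> b' = b - 2 * a * q -> c' = c + b * q - a * q ^+ 2 ->
    0 < c' -> b < M -> - M <= b' ->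
  chain (inner M) (a, b, c) (a, b', c') (run_sum a b c q).
Proof.
move=> a0 c0 q0 -> -> c'0 bM Mb'; apply: chain_right => // j j0 jq.
have aj : 0 <= a * j by rewrite mulr_ge0 // ltW.
have aq : 0 <= a * (q - j - 1).
  by apply: mulr_ge0; [exact: ltW | move: jq; clear; lia].
by rewrite /inner /=; move: bM Mb' aj aq a0; clear; lia.
Qed.

Lemma chain_left_inner d M (a b c q a' b' : int) :
    (forall x, x ^+ 2 != d) -> simple d (a, b, c) ->
    0 <= q -> a' = a - b * q - c * q ^+ 2 -> b' = b + 2 * c * q ->
    0 < a' -> - M < b -> b' <= M ->
  chain (inner M) (a, b, c) (a', b', c) (run_sum c (- b) a q).
Proof.
move=> nsq w_simple q0 -> -> a'0 Mb bM; apply: (chain_left d) => // j j0 jq.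
have [a0 c0 _] := simpleP _ _ _ _ w_simple.
have cj : 0 <= c * j by rewrite mulr_ge0 // ltW.
have cq : 0 <= c * (q - j - 1).
  by apply: mulr_ge0; [exact: ltW | move: jq; clear; lia].
by rewrite /inner /=; move: Mb bM cj cq c0; clear; lia.
Qed.

(** The principal cycle meets [|b| = M] once more after its start: its first run leads from
    [(1, M, E2)] to [(1, - M, E2)]. *)
Definition inner_or (M E2 : int) (x : int * int * int) : bool :=
  inner M x || (x == (1, - M, E2)).

Lemma chain_right_outer M (a b c q b' c' : int) E2 :
    0 < a -> 0 < c -> 0 <= q -> b' = b - 2 * a * q -> c' = c + b * q - a * q ^+ 2 ->
    0 < c' -> b < M -> - M <= b' ->
  chain (inner_or M E2) (a, b, c) (a, b', c') (run_sum a b c q).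
Proof.
move=> *; apply: (@chain_sub (inner M)) => [x|]; first by rewrite /inner_or => ->.
exact: chain_right_inner.
Qed.

Lemma chain_left_outer d M (a b c q a' b' : int) E2 :
    (forall x, x ^+ 2 != d) -> simple d (a, b, c) ->
    0 <= q -> a' = a - b * q - c * q ^+ 2 -> b' = b + 2 * c * q ->
    0 < a' -> - M < b -> b' <= M ->
  chain (inner_or M E2) (a, b, c) (a', b', c) (run_sum c (- b) a q).
Proof.
move=> *; apply: (@chain_sub (inner M)) => [x|]; first by rewrite /inner_or => ->.
exact: (chain_left_inner d).
Qed.

(** The single left step out of the exceptional form that [inner_or] admits. *)
Lemma chain_left_corner d M (c a' b' : int) :
    (forall x, x ^+ 2 != d) -> simple d (1, - M, c) ->
    a' = 1 + M - c -> b' = 2 * c - M -> 0 < a' ->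
  chain (inner_or M c) (1, - M, c) (a', b', c) (run_sum c M 1 1).
Proof.
move=> nsq w_simple a'E b'E a'0.
apply: (@chain_eq _ _ (1 - - M * 1 - c * 1 ^+ 2, - M + 2 * c * 1, c)
          _ (run_sum c (- - M) 1 1)); last 2 first.
- by rewrite a'E b'E; congr (_, _, _); ring.
- by rewrite opprK.
apply: (chain_left d) => //; first by move: a'E a'0; clear; lia.
move=> j j0 j1; have -> : j = 0 by move: j0 j1; clear; lia.
by rewrite /inner_or; apply/orP; right; apply/eqP; congr (_, _, _); ring.
Qed.

(* Here n = 2 N and E = (2 n + r - 1)/8.  The ring of integers is represented by
   (1, n - 1, 2 E), a prime above 2 by (2, n - 1, E).  Distinctness of the three
   classes is read off the extreme values |b| = n - 1 alone, which is what
   [inner] keeps track of. *)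
Section Cycles.

Variables d r N E : int.
Hypothesis nsq : forall x : int, x ^+ 2 != d.
Hypothesis dE : d = 4 * N ^+ 2 + r.
Hypothesis rE : r = 8 * E - 4 * N + 1.

Notation M := (2 * N - 1).

(* The chains start one step after the form at which they end. *)
Definition cycle_sums (SO SP : rat) : Prop :=
  [/\ chain (inner_or M (2 * E)) (1, 2 * N - 3, 2 * N + 2 * E - 2) (1, M, 2 * E) SO,
      chain (inner M) (2, 2 * N - 5, 2 * N + E - 3) (2, M, E) SP &
      weight (1, M, 2 * E) + SO + 2 * (weight (2, M, E) + SP) =
       (2 * (2 * N%:Q) ^+ 3 * (r%:Q ^+ 2 + 1)
         + 2 * N%:Q * (3 * r%:Q ^+ 3 + 170 * r%:Q ^+ 2 + 3 * r%:Q))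
       / (8 * r%:Q ^+ 2)].

(* With R, L for the two branches of [step] and m = n/r = 2 mu, the full cycles are
   R^(n-1) L R L^(m-1) R L and R^(n/2-1) L R^3 L^(m/2-1) R L^3. *)
Lemma cycle_sums_pos (mu : int) :
    5 <= r -> 1 <= mu -> N = r * mu -> 3 * r + 5 < 4 * N ->
  exists SO SP, cycle_sums SO SP.
Proof.
move=> r5 mu1 NE bound.
have rN : r <= N by rewrite NE ler_peMr //; move: r5; clear; lia.
eexists; eexists; split.
- apply: chain_trans.
    apply: (@chain_right_outer _ _ _ _ (2 * N - 2) (- M) (2 * E));
      move: rE r5 rN bound; clear; lia.
  apply: chain_trans.
    apply: (@chain_left_corner d _ _ (2 * N - 2 * E) (4 * E - M)) => //;
      try (move: rE r5 rN bound; clear; lia).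
    apply/simpleP; split; try (move: rE r5 rN bound; clear; lia); rewrite dE rE; ring.
  apply: chain_trans.
    apply: (@chain_right_outer _ _ _ _ 1 (r - 2 * N) r);
      move: rE r5 rN bound; clear; lia.
  apply: chain_trans.
    (* This run has length [n/r - 1]; its end simplifies only through the product [N = r * mu]. *)
    apply: (@chain_left_outer d _ _ _ _ (2 * mu - 1) (2 * N - 2 * E) (2 * N - r)) => //;
      try (move: mu1 rE r5 rN bound; clear; lia).
    + apply/simpleP; split; try (move: rE r5 rN bound; clear; lia); rewrite dE rE; ring.
    + by rewrite NE; ring.
    + by rewrite NE; ring.
  apply: chain_trans.
    apply: (@chain_right_outer _ _ _ _ 1 (4 * E - 2 * N - r) (2 * E));
      move: rE r5 rN bound; clear; lia.
  apply: (@chain_left_outer d _ _ _ _ 1 1) => //;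
      try (move: mu1 rE r5 rN bound; clear; lia).
  apply/simpleP; split; try (move: rE r5 rN bound; clear; lia); rewrite dE rE; ring.
- apply: chain_trans.
    apply: (@chain_right_inner _ _ _ _ (N - 2) (3 - 2 * N) (N - 1 + E));
      move: rE r5 rN bound; clear; lia.
  apply: chain_trans.
    apply: (@chain_left_inner d _ _ _ _ 1 (N - E) (2 * E + 1)) => //;
      try (move: mu1 rE r5 rN bound; clear; lia).
    apply/simpleP; split; try (move: rE r5 rN bound; clear; lia); rewrite dE rE; ring.
  apply: chain_trans.
    apply: (@chain_right_inner _ _ _ _ 3 (r - 2 * N) (2 * r));
      move: rE r5 rN bound; clear; lia.
  apply: chain_trans.
    apply: (@chain_left_inner d _ _ _ _ (mu - 1) (2 * N - E - r) (2 * N - 3 * r)) => //;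
      try (move: mu1 rE r5 rN bound; clear; lia).
    + apply/simpleP; split; try (move: rE r5 rN bound; clear; lia); rewrite dE rE; ring.
    + by rewrite NE; ring.
    + by rewrite NE; ring.
  apply: chain_trans.
    (* [3 * r + 5 < 4 * N] says that [2 * N - 6 * E - 1 > - M]. Equality, which is the case
       [d = 105], would put the conjugate [(2, - M, E)] on the cycle of P. *)
    apply: (@chain_right_inner _ _ _ _ 1 (2 * N - 6 * E - 1) E);
      move: rE r5 rN bound; clear; lia.
  apply: (@chain_left_inner d _ _ _ _ 3 2) => //;
      try (move: mu1 rE r5 rN bound; clear; lia).
  apply/simpleP; split; try (move: rE r5 rN bound; clear; lia); rewrite dE rE; ring.
have r0 : r%:Q != 0 by rewrite intr_eq0; move: r5; clear; lia.
(* Eliminating [N] and [E] leaves an identity of rational functions in [r] and [mu]. *)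
have NQ : N%:Q = r%:Q * mu%:Q by rewrite NE rmorphM ?rmorphN.
have EQ : E%:Q = (r%:Q + 4 * (r%:Q * mu%:Q) - 1) / 8.
  by rewrite -NQ rE !(rmorphD, rmorphB, rmorphM) /=; field.
rewrite /run_sum /weight /= !(rmorphD, rmorphB, rmorphM, rmorphN) /= NQ EQ; field.
exact: r0.
Qed.

(* With m = n/|r|, the full cycles are R^(n-1) L^2 R^(m-1) L^2 and
   R^(n/2-1) L R^2 L R^(m/2-1) L^4. *)
Lemma cycle_sums_neg (mu : int) :
    r <= - 3 -> 1 <= mu -> N = - r * mu -> 3 - 3 * r < 4 * N ->
  exists SO SP, cycle_sums SO SP.
Proof.
move=> r3 mu1 NE bound.
have rN : - r <= N by rewrite NE ler_peMr //; move: r3; clear; lia.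
eexists; eexists; split.
- apply: chain_trans.
    apply: (@chain_right_outer _ _ _ _ (2 * N - 2) (- M) (2 * E));
      move: rE r3 rN bound; clear; lia.
  apply: chain_trans.
    apply: (@chain_left_corner d _ _ (2 * N - 2 * E) (4 * E - M)) => //;
      try (move: rE r3 rN bound; clear; lia).
    apply/simpleP; split; try (move: rE r3 rN bound; clear; lia); rewrite dE rE; ring.
  apply: chain_trans.
    apply: (@chain_left_outer d _ _ _ _ 1 (- r) (2 * N + r)) => //;
      try (move: mu1 rE r3 rN bound; clear; lia).
    apply/simpleP; split; try (move: rE r3 rN bound; clear; lia); rewrite dE rE; ring.
  apply: chain_trans.
    apply: (@chain_right_outer _ _ _ _ (2 * mu - 1) (- r - 2 * N) (2 * E));
      try (move: mu1 rE r3 rN bound; clear; lia).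
    + by rewrite NE; ring.
    + by rewrite NE; ring.
  apply: (@chain_left_outer d _ _ _ _ 2 1) => //;
      try (move: mu1 rE r3 rN bound; clear; lia).
  apply/simpleP; split; try (move: rE r3 rN bound; clear; lia); rewrite dE rE; ring.
- apply: chain_trans.
    apply: (@chain_right_inner _ _ _ _ (N - 2) (3 - 2 * N) (N - 1 + E));
      move: rE r3 rN bound; clear; lia.
  apply: chain_trans.
    apply: (@chain_left_inner d _ _ _ _ 1 (N - E) (2 * E + 1)) => //;
      try (move: mu1 rE r3 rN bound; clear; lia).
    apply/simpleP; split; try (move: rE r3 rN bound; clear; lia); rewrite dE rE; ring.
  apply: chain_trans.
    (* [3 - 3 * r < 4 * N] says that [6 * E + 1 - 4 * N > - M]. Equality, which is the case
       [d = 33], would put [(2 * E, - M, 1)], the [swap] of the principal form, on the cycle of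
       P. *)
    apply: (@chain_right_inner _ _ _ _ 2 (6 * E + 1 - 4 * N) (9 * E - 3 * N + 1));
      move: rE r3 rN bound; clear; lia.
  apply: chain_trans.
    apply: (@chain_left_inner d _ _ _ _ 1 (- 2 * r) (2 * N + 3 * r)) => //;
      try (move: mu1 rE r3 rN bound; clear; lia).
    apply/simpleP; split; try (move: rE r3 rN bound; clear; lia); rewrite dE rE; ring.
  apply: chain_trans.
    apply: (@chain_right_inner _ _ _ _ (mu - 1) (- r - 2 * N) E) => //;
      try (move: mu1 rE r3 rN bound; clear; lia).
    + by rewrite NE; ring.
    + have -> : 9 * E - 3 * N + 1 = E + N + r by rewrite rE; ring.
      by rewrite NE; ring.
  apply: (@chain_left_inner d _ _ _ _ 4 2) => //;
      try (move: mu1 rE r3 rN bound; clear; lia).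
  apply/simpleP; split; try (move: rE r3 rN bound; clear; lia); rewrite dE rE; ring.
have r0 : r%:Q != 0 by rewrite intr_eq0; move: r3; clear; lia.
have NQ : N%:Q = - r%:Q * mu%:Q by rewrite NE rmorphM ?rmorphN.
have EQ : E%:Q = (r%:Q + 4 * (- r%:Q * mu%:Q) - 1) / 8.
  by rewrite -NQ rE !(rmorphD, rmorphB, rmorphM) /=; field.
rewrite /run_sum /weight /= !(rmorphD, rmorphB, rmorphM, rmorphN) /= NQ EQ; field.
exact: r0.
Qed.

End Cycles.

(** * Orbits and the sigma sum *)

Definition orbit_seq (w : int * int * int) (K : nat) : seq (int * int * int) :=
  traject step w K ++ [seq swap x | x <- traject step w K].

Section Orbits.

Variables (d : int) (w0 : int * int * int) (k : nat).
Hypothesis nsq : forall x : int, x ^+ 2 != d.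
Hypothesis w0_simple : simple d w0.
Hypothesis period : iter k step (step w0) = w0.

Lemma iter_period m : iter (m * k.+1) step w0 = w0.
Proof. by elim: m => // m IH; rewrite mulSn iterD IH iterSr. Qed.

Lemma iter_mem_traject m : iter m step w0 \in traject step w0 k.+1.
Proof.
apply/trajectP; exists (m %% k.+1)%N; first exact: ltn_pmod.
by rewrite {1}(divn_eq m k.+1) addnC iterD iter_period.
Qed.

Lemma equivalent_mem_orbit w : simple d w -> equivalent w0 w -> w \in orbit_seq w0 k.+1.
Proof.
move=> w_s [p [q [s [t [D H]]]]]; rewrite mem_cat.
have in_cycle x : simple d x -> act p q s t w0 = x -> x \in traject step w0 k.+1.
  move=> x_s xE; have [|m] := step_act d nsq w0 p q s t w0_simple D; first by rewrite xE.
  rewrite xE => -[mE|<-]; last exact: iter_mem_traject.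
  (* A form that reaches [w0] after [m] steps is [w0] advanced by [m * k] steps, since [m] further
     steps complete [m] periods. *)
  suff -> : x = iter (m * k) step w0 by exact: iter_mem_traject.
  apply: (iter_step_inj d nsq m) => //; first exact: (iter_step_simple d nsq).
  by rewrite mE -iterD -mulnS iter_period.
case: H => /in_cycle h; first by rewrite h.
rewrite -[w in X in _ || X]swapK map_f ?orbT //; apply: h; exact: swap_simple.
Qed.

Lemma orbit_seq_simple w : w \in orbit_seq w0 k.+1 -> simple d w.
Proof.
have cyc x : x \in traject step w0 k.+1 -> simple d x.
  by move=> /trajectP[m _ ->]; apply: (iter_step_simple d nsq).
by rewrite mem_cat => /orP[/cyc //|/mapP[x /cyc x_s ->]]; apply: swap_simple.
Qed.

Hypothesis w0_notin : w0 \notin traject step (step w0) k.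
Hypothesis swap_notin : swap w0 \notin traject step w0 k.+1.

(** The first hypothesis makes [k.+1] the least period. A form common to the cycle and its [swap]
    would, by injectivity of [step], put [swap w0] on the cycle. *)
Lemma orbit_seq_uniq : uniq (orbit_seq w0 k.+1).
Proof.
have iter_s m : simple d (iter m step w0) by exact: (iter_step_simple d nsq).
have uniq_c : uniq (traject step w0 k.+1).
  rewrite looping_uniq; apply/negP => /trajectP[i ik iE].
  have e : iter (k - i) step w0 = w0.
    apply: (iter_step_inj d nsq i) => //; by rewrite -iterD subnKC // ltnW.
  move/negP: w0_notin; apply; apply/trajectP; exists (k - i).-1.
    by rewrite -subnS ltn_subrL //; case: (k) ik.
  by rewrite -iterSr prednK ?subn_gt0 // e.
rewrite cat_uniq uniq_c map_inj_uniq ?uniq_c ?andbT //; last exact: can_inj swapK.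
apply/hasPn => _ /mapP[_ /trajectP[j jk ->] ->]; apply/negP => /trajectP[i ik e].
move/negP: swap_notin; apply.
have [ji|/ltnW ij] := leqP j i.
  suff -> : swap w0 = iter (i - j) step w0 by apply: iter_mem_traject.
  apply: (iter_step_inj d nsq j) => //; first exact: swap_simple.
  by rewrite (iter_step_swap d) // e -iterD subnKC.
suff -> : swap w0 = iter (j - i) step w0 by apply: iter_mem_traject.
apply: (can_inj swapK); rewrite swapK; apply: (iter_step_inj d nsq i) => //.
  exact: swap_simple.
by rewrite (iter_step_swap d) // -iterD subnKC.
Qed.

Lemma sum_orbit_seq (S : rat) :
  \sum_(x <- traject step (step w0) k) weight x = S ->
  \sum_(x <- orbit_seq w0 k.+1) x.1.1%:Q = weight w0 + S.
Proof.
move=> <-; transitivity (\sum_(x <- traject step w0 k.+1) weight x); last by rewrite big_cons.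
rewrite big_cat big_map /= -big_split /=.
by apply: eq_bigr => -[[a b] c] _; rewrite /weight /= rmorphD.
Qed.

End Orbits.

(** The crude range from [- d] to [d] loses nothing for [d > 0] and keeps the list computable, which
    serves the two exceptional values of [d]. *)
Definition middle_coefs (d : int) : seq int :=
  [seq b <- [seq i%:Z - d | i <- iota 0 (2 * `|d|%N).+1]
     | (b ^+ 2 < d) && ((b ^+ 2 == d %[mod 4])%Z)].

Definition forms (d : int) : seq (int * int * int) :=
  [seq (a%:Z, b, (((d - b ^+ 2) %/ 4)%Z %/ a%:Z)%Z) |
     b <- middle_coefs d, a <- divisors `|((d - b ^+ 2) %/ 4)%Z|%N].

Section Forms.

Variable d : int.
Hypothesis d_gt0 : 0 < d.
Hypothesis nsq : forall x : int, x ^+ 2 != d.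

Lemma mem_middle_coefs b :
  (b \in middle_coefs d) = (b ^+ 2 < d) && ((b ^+ 2 == d %[mod 4])%Z).
Proof.
rewrite mem_filter andb_idr // => /andP[bd _].
have [b1 b2] : - d <= b /\ b <= d.
  have := sqr_ge0 (b - 1); have := sqr_ge0 (b + 1); rewrite sqrrD sqrrB.
  by move: bd d_gt0; clear; split; nia.
apply/mapP; exists `|(b + d)%R|%N; last first.
  by rewrite abszE ger0_norm; move: b1; clear; lia.
rewrite mem_iota; move: b1 b2 d_gt0; clear; lia.
Qed.

Lemma mem_forms w : (w \in forms d) = simple d w.
Proof.
case: w => [[a b] c]; apply/allpairsPdep/simpleP.
  move=> [b' [a' [b'_in a'_in [-> -> ->]]]]; move: b'_in; rewrite mem_middle_coefs.
  move=> /andP[b'd b'4].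
  have [m mE] : exists m, d - b' ^+ 2 = 4 * m.
    by exists ((d - b' ^+ 2) %/ 4)%Z; move: b'4; clear; lia.
  have m_gt0 : 0 < m by move: b'd mE; clear; lia.
  move: a'_in; rewrite mE mulKz // -dvdn_divisors; last by move: m_gt0; clear; lia.
  move=> a'm; have /dvdzP[q qE] : (a'%:Z %| m)%Z by [].
  have a'_gt0 : 0 < a'%:Z.
    by move: a'm m_gt0; clear; case: a' => //; rewrite dvd0n; lia.
  rewrite qE mulzK ?gt_eqF //; split=> //.
    by move: m_gt0; rewrite qE pmulr_lgt0.
  by move: mE; rewrite qE; clear; lia.
move=> [a_gt0 c_gt0 bd].
have ac_gt0 : 0 < a * c by rewrite mulr_gt0.
have acE : ((d - b ^+ 2) %/ 4)%Z = a * c by rewrite -bd; clear; lia.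
exists b, `|a|%N; rewrite acE; split.
- by rewrite mem_middle_coefs -bd; move: ac_gt0; clear; lia.
- by rewrite -dvdn_divisors ?abszM ?dvdn_mulr // muln_gt0 !absz_gt0 !gt_eqF.
- by rewrite abszE gtr0_norm // [a * c]mulrC mulzK // gt_eqF.
Qed.

Lemma forms_uniq : uniq (forms d).
Proof.
apply: allpairs_uniq_dep.
- apply: filter_uniq; rewrite map_inj_uniq ?iota_uniq //.
  by move=> i j /addIr[].
- by move=> b _; apply: divisors_uniq.
- by move=> [b a] [b' a'] _ _ /= [-> ->].
Qed.

Lemma sigma_sum_forms : sigma_sum d = \sum_(w <- forms d) w.1.1%:Q.
Proof.
have lt_sqrt (t : int) : (`|t%:~R| < sqrtC d%:~R :> algC) = (t ^+ 2 < d).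
  rewrite -(@ltr_pXn2r _ 2) ?nnegrE ?normr_ge0 ?sqrtC_ge0 ?ler0z ?(ltW d_gt0) //.
  by rewrite sqrtCK -intr_norm -rmorphXn /= ltr_int real_normK ?num_real.
rewrite /sigma_sum; set A := (X in \sum_(t \in X) _).
have -> : A = [set` middle_coefs d]%classic.
  apply/seteqP; split=> t; rewrite /A /= mem_middle_coefs lt_sqrt.
    by move=> [-> /eqP].
  by move=> /andP[-> /eqP].
rewrite -fsbig_seq; last by apply: filter_uniq; rewrite map_inj_uniq ?iota_uniq // => i j /addIr[].
rewrite /forms big_allpairs_dep /=; apply: eq_bigr => b _.
by rewrite /sigma natr_sum; apply: eq_bigr.
Qed.

End Forms.

(** * Ideal classes *)

Lemma monic_quadratic (R : nzRingType) (s c : R) :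
  size ('X^2 - s *: 'X + c%:P) = 3%N /\ 'X^2 - s *: 'X + c%:P \is monic.
Proof.
have size_g : size ('X^2 - s *: 'X + c%:P) = 3%N.
  rewrite -addrA size_polyDl size_polyXn //.
  apply: leq_ltn_trans (size_polyD _ _) _; rewrite gtn_max size_polyN size_polyC.
  rewrite (leq_ltn_trans (size_scale_leq _ _)) ?size_polyX //=.
  by case: (_ != 0).
by rewrite monicE lead_coefE size_g /= !coefE /= mulr0 subr0 addr0.
Qed.

Lemma unit_det (x y : int) : x * y = 1 -> x = 1 \/ x = -1.
Proof.
move=> xy; have : (x %| 1)%Z by apply/dvdzP; exists y; rewrite mulrC xy.
by rewrite dvdz1; lia.
Qed.

Section Ideals.

Local Open Scope classical_set_scope.

Variables d k : int.
Hypothesis dE : d = 4 * k + 1.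
Hypothesis d_gt0 : 0 < d.
Hypothesis nsq : forall x : int, x ^+ 2 != d.
Hypothesis sqf : squarefree d.

Notation delta := (sqrtC d%:~R : algC).
Notation OK := (ring_of_integers (quadratic_field d)).

(** * Arithmetic of the ring of integers *)

Lemma delta2 : delta ^+ 2 = d%:~R.
Proof. exact: sqrtCK. Qed.

Lemma delta_Aint : delta \in Aint.
Proof.
apply: (@root_monic_Aint ('X^2 - (d%:~R)%:P)).
- by rewrite rootE !hornerE delta2 subrr.
- exact: monicXnsubC.
- by rewrite polyOverXnsubC intr_int.
Qed.

Lemma delta_irrational (x y : rat) : ratr x + ratr y * delta = 0 -> x = 0 /\ y = 0.
Proof.
move=> xy0; have [y0|y_neq0] := eqVneq y 0.
  move: xy0; rewrite y0 rmorph0 mul0r addr0 => /eqP.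
  by rewrite fmorph_eq0 => /eqP.
have delta_rat : delta = ratr (- x / y).
  rewrite fmorph_div rmorphN; apply: (mulIf (x := ratr y)); first by rewrite fmorph_eq0.
  rewrite divfK ?fmorph_eq0 // mulrC; apply/eqP; rewrite -addr_eq0 addrC; exact/eqP.
have /intrP[m mE] : delta \in Num.int.
  by apply: Cint_rat_Aint delta_Aint; rewrite delta_rat Crat_rat.
have /eqP[] := nsq m; apply: (@intr_inj algC).
by rewrite rmorphXn /= -mE delta2.
Qed.

Lemma delta_irrational_int (x y : int) :
  x%:~R + y%:~R * delta = 0 -> x = 0 /\ y = 0.
Proof.
move=> xy0; have [] := delta_irrational x%:Q y%:Q; first by rewrite !ratr_int.
by move=> /eqP; rewrite intr_eq0 => /eqP -> /eqP; rewrite intr_eq0 => /eqP ->.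
Qed.

(** Coordinates in the integral basis 1, omega with [omega = (1 + delta) / 2]; the product rule
    comes from [omega^2 = omega + k]. *)
Definition qint (u v : int) : algC := u%:~R + v%:~R * ((1 + delta) / 2).

Lemma qint_eq0 u v : qint u v = 0 -> u = 0 /\ v = 0.
Proof.
move=> E0; have /delta_irrational_int[uv v0] : (2 * u + v)%:~R + v%:~R * delta = 0.
  by rewrite -[RHS](mulr0 2) -E0 /qint; field.
by split; [move: uv v0; clear; lia | exact: v0].
Qed.

Lemma qintD u v u' v' : qint u v + qint u' v' = qint (u + u') (v + v').
Proof. by rewrite /qint; field. Qed.

Lemma qintM u v u' v' :
  qint u v * qint u' v' = qint (u * u' + k * (v * v')) (u * v' + v * u' + v * v').
Proof.
have d2 : delta ^+ 2 = 4 * k%:~R + 1 by rewrite delta2 dE rmorphD rmorphM.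
by rewrite /qint; field: d2.
Qed.

(** The square of the denominator is coprime to the numerator, hence divides [d]. *)
Lemma squarefree_rat (x : rat) (m : int) : x ^+ 2 * d%:Q = m%:Q -> exists n : int, x = n%:Q.
Proof.
move=> xm; exists (numq x); rewrite -[LHS]divq_num_den.
suff -> : denq x = 1 by rewrite divr1.
have dx0 : (denq x)%:Q != 0 by rewrite intr_eq0 denq_eq0.
have e : numq x ^+ 2 * d = m * denq x ^+ 2.
  apply: (@intr_inj rat); rewrite rmorphM rmorphXn [RHS]rmorphM rmorphXn /= -xm -{2}[x]divq_num_den.
  by field.
have : (denq x ^+ 2 %| d)%Z.
  have co : coprimez (denq x ^+ 2) (numq x ^+ 2).
    apply: coprimezXl; apply: coprimezXr.
    by rewrite coprimezE coprime_sym coprime_num_den.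
  by rewrite -(Gauss_dvdzr _ co) e dvdz_mull.
by move=> /sqf; rewrite gtr0_norm ?denq_gt0.
Qed.

(** Trace and norm are, up to sign, coefficients of the minimal polynomial, which has degree 2
    because [delta] is irrational and [b != 0]. *)
Lemma Aint_quadratic (a b : rat) : b != 0 -> ratr a + ratr b * delta \in Aint ->
  (exists t : int, 2 * a = t%:Q) /\ (exists m : int, a ^+ 2 - b ^+ 2 * d%:Q = m%:Q).
Proof.
move=> b0; set z := (X in X \in Aint) => z_int.
pose g : {poly rat} := 'X^2 - (2 * a) *: 'X + (a ^+ 2 - b ^+ 2 * d%:Q)%:P.
have [size_g g_monic] := monic_quadratic _ (2 * a) (a ^+ 2 - b ^+ 2 * d%:Q).
have [p [pE p_monic] p_div] := minCpolyP z.
have pg : p %| g.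
  rewrite -p_div rootE /g rmorphD rmorphB /= map_polyXn map_polyZ map_polyX map_polyC /=.
  have -> : ratr (a ^+ 2 - b ^+ 2 * d%:Q) = ratr a ^+ 2 - ratr b ^+ 2 * delta ^+ 2.
    by rewrite delta2 rmorphB /= rmorphXn /= rmorphM /= rmorphXn /= ratr_int.
  rewrite !hornerE /= rmorphM /= ratr_nat.
  by apply/eqP; rewrite /z; ring.
have pz : root (map_poly ratr p) z by rewrite p_div dvdpp.
have size_p : (2 < size p)%N.
  rewrite ltnNge; apply/negP => size_p.
  move: pz; rewrite rootE (@horner_coef_wide _ 2) ?size_map_poly //.
  rewrite !big_ord_recl big_ord0 /= !coef_map /= addr0 expr0 mulr1 expr1 /z => /eqP pz.
  have [] := delta_irrational (p`_0 + p`_1 * a) (p`_1 * b).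
    by rewrite -[RHS]pz /bump /= !(rmorphD, rmorphM) /=; ring.
  move=> p0 /eqP; rewrite mulf_eq0 (negbTE b0) orbF => /eqP p1.
  move: p0; rewrite p1 mul0r addr0 => p0.
  have := monic_neq0 p_monic; rewrite -size_poly_eq0 => /negP[].
  rewrite size_poly_eq0; apply/eqP/polyP => i; rewrite coef0.
  case: i => [//|[//|i]]; apply: nth_default; exact: leq_trans size_p _.
have pgE : p = g.
  apply/eqP; rewrite -eqp_monic // -dvdp_size_eqp // eqn_leq dvdp_leq ?monic_neq0 //.
  by rewrite size_g.
move: z_int; rewrite unfold_in pE pgE => /polyOverP int_coef; split.
- have := int_coef 1%N; rewrite coef_map /= /g !coefE /= => /intrP[m mE].
  exists (- m); apply: (@fmorph_inj _ _ (ratr : rat -> algC)).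
  by rewrite /= ratr_int rmorphN /= -mE -rmorphN /=; congr ratr; ring.
- have := int_coef 0%N; rewrite coef_map /= /g !coefE /= => /intrP[m mE].
  exists m; apply: (@fmorph_inj _ _ (ratr : rat -> algC)).
  by rewrite /= ratr_int -mE; congr ratr; ring.
Qed.

Lemma OKP z : OK z <-> exists u v : int, z = qint u v.
Proof.
split; last first.
  move=> [u [v ->]]; split.
    exists (u%:Q + v%:Q / 2), (v%:Q / 2).
    by rewrite !(rmorphD, rmorphM, fmorphV) /= !ratr_int /qint; field.
  apply: rpredD; first exact: Aint_int.
  apply: rpredM; first exact: Aint_int.
  apply: (@root_monic_Aint ('X^2 - 1 *: 'X + (- k%:~R)%:P)).
  - have d2 : delta ^+ 2 = 4 * k%:~R + 1 by rewrite delta2 dE rmorphD rmorphM.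
    by rewrite rootE !hornerE /=; apply/eqP; field: d2.
  - by have [] := monic_quadratic _ (1 : algC) (- k%:~R).
  - apply/polyOverP => i; rewrite scale1r coefD coefB coefXn coefX coefC.
    by rewrite rpredD ?rpredB ?rpred_nat //; case: ifP; rewrite ?rpredN ?intr_int ?rpred0.
move=> [[a [b zE]] z_int]; have [b0|b0] := eqVneq b 0.
  move: zE; rewrite b0 rmorph0 mul0r addr0 => zE.
  have /intrP[m mE] : z \in Num.int by apply: Cint_rat_Aint => //; rewrite zE Crat_rat.
  by exists m, 0; rewrite /qint mul0r addr0.
move: z_int; rewrite zE => /Aint_quadratic[//|[t tE] [m mE]].
have [v vE] : exists v : int, 2 * b = v%:Q.
  apply: (@squarefree_rat _ (t ^+ 2 - 4 * m)).
  by rewrite rmorphB rmorphXn rmorphM /= -tE -mE; ring.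
have tv : t ^+ 2 - v ^+ 2 * d = 4 * m.
  apply: (@intr_inj rat); by rewrite rmorphB /= rmorphXn /= !rmorphM /= -tE -mE -vE; ring.
(* As [d = 1] modulo 4, [t^2 = v^2] modulo 4, so [t] and [v] have the same parity. *)
have [u uE] : exists u : int, t = 2 * u + v.
  have [q [qE|qE]] : exists q : int, t - v = 2 * q \/ t - v = 2 * q + 1.
    by exists ((t - v) %/ 2)%Z; lia.
    by exists q; move: qE; clear; lia.
  have tE' : t = v + 2 * q + 1 by move: qE; clear; lia.
  by exfalso; move: tv; rewrite tE' dE; clear; lia.
exists u, v; rewrite /qint.
have -> : a = (2 * u%:Q + v%:Q) / 2.
  apply: (mulfI (x := 2)) => //; rewrite tE uE rmorphD rmorphM /=; by field.
have -> : b = v%:Q / 2 by rewrite -vE; field.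
by rewrite !(rmorphD, rmorphM, fmorphV) /= !ratr_int; field.
Qed.

Lemma OK_qint u v : OK (qint u v).
Proof. by apply/OKP; exists u, v. Qed.

Lemma OK_M x y : OK x -> OK y -> OK (x * y).
Proof.
by move=> /OKP[u [v ->]] /OKP[u' [v' ->]]; rewrite qintM; apply: OK_qint.
Qed.

Lemma ideal_equivP (I J : set algC) (x y : algC) : OK x -> OK y -> x != 0 -> y != 0 ->
  (forall z, I z -> exists2 z', J z' & x * z = y * z') ->
  (forall z, J z -> exists2 z', I z' & x * z' = y * z) ->
  ideal_equiv OK I J.
Proof.
move=> Ox Oy x0 y0 IJ JI; exists x, y; split=> //; apply/seteqP; split=> _ /= [z Iz <-].
  by have [z' Jz' ->] := IJ z Iz; exists z'.
by have [z' Iz' <-] := JI z Iz; exists z'.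
Qed.

Lemma ideal_equiv_refl I : ideal_equiv OK I I.
Proof.
have O1 : OK 1 by apply/OKP; exists 1, 0; rewrite /qint mul0r addr0.
by exists 1, 1; split=> //; exact: oner_neq0.
Qed.

Lemma ideal_equiv_sym I J : ideal_equiv OK I J -> ideal_equiv OK J I.
Proof. by move=> [x [y [? ? ? ? e]]]; exists y, x; split. Qed.

Lemma ideal_equiv_trans I J K :
  ideal_equiv OK I J -> ideal_equiv OK J K -> ideal_equiv OK I K.
Proof.
move=> [x [y [Ox Oy x0 y0 IJ]]] [x' [y' [Ox' Oy' x'0 y'0 JK]]].
apply: (@ideal_equivP _ _ (x * x') (y * y')); rewrite ?mulf_neq0 //; try exact: OK_M.
  move=> z Iz; have [z1 Jz1 e1] : [set y * w | w in J] (x * z) by rewrite -IJ; exists z.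
  have [z2 Kz2 e2] : [set y' * w | w in K] (x' * z1) by rewrite -JK; exists z1.
  by exists z2 => //; ring: e1 e2.
move=> z Kz; have [z1 Jz1 e1] : [set x' * w | w in J] (y' * z) by rewrite JK; exists z.
have [z2 Iz2 e2] : [set x * w | w in I] (y * z1) by rewrite IJ; exists z1.
by exists z2 => //; ring: e1 e2.
Qed.

(** * Ideals attached to forms *)

Definition theta (b : int) : algC := (b%:~R + delta) / 2.

Definition lattice (a b : int) : set algC :=
  [set z | exists x y : int, z = x%:~R * a%:~R + y%:~R * theta b].

Lemma thetaE (b : int) : theta (2 * b + 1) = qint b 1.
Proof. by rewrite /theta /qint; field. Qed.

Lemma odd_middle (a b c : int) : b ^+ 2 + 4 * a * c = d -> exists g, b = 2 * g + 1.
Proof.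
move=> bd; exists ((b - 1) %/ 2)%Z.
have [q [qE|qE]] : exists q : int, b = 2 * q \/ b = 2 * q + 1.
  by exists (b %/ 2)%Z; lia.
- by exfalso; move: bd; rewrite qE dE; clear; lia.
- by move: qE; clear; lia.
Qed.

Lemma lattice_comb_inj (a b x y x' y' : int) : a != 0 ->
  x%:~R * a%:~R + y%:~R * theta b = x'%:~R * a%:~R + y'%:~R * theta b ->
  x = x' /\ y = y'.
Proof.
move=> a0 e.
have [] := delta_irrational_int (2 * (x - x') * a + (y - y') * b) (y - y').
  transitivity (2 * ((x%:~R * a%:~R + y%:~R * theta b)
      - (x'%:~R * a%:~R + y'%:~R * theta b))); first by rewrite /theta; field.
  by rewrite e subrr mulr0.
move=> e1 /eqP; rewrite subr_eq0 => /eqP yy'; split=> //.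
move: e1; rewrite yy' subrr mul0r addr0 => /eqP.
by rewrite !mulf_eq0 (negbTE a0) /= orbF subr_eq0 => /eqP.
Qed.

Lemma lattice_ideal (a b c : int) : a != 0 -> b ^+ 2 + 4 * a * c = d ->
  nonzero_ideals OK (lattice a b).
Proof.
move=> a0 bd; have [g bE] := odd_middle _ _ _ bd.
have acE : k = g ^+ 2 + g + a * c by move: bd; rewrite bE dE; clear; lia.
have latE z : lattice a b z <-> exists x y : int, z = qint (x * a + y * g) y.
  by split=> -[x [y ->]]; exists x, y; rewrite bE thetaE /qint; field.
split; last first.
  exists a%:~R; last by rewrite intr_eq0.
  by exists 1, 0; rewrite mul0r addr0 mul1r.
split.
- by move=> z /latE[x [y ->]]; apply: OK_qint.
- by apply/latE; exists 0, 0; rewrite /qint; field.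
- move=> z z' /latE[x [y ->]] /latE[x' [y' ->]]; apply/latE.
  by exists (x + x'), (y + y'); rewrite qintD; congr qint; ring.
- move=> z z' /OKP[u [v ->]] /latE[x [y ->]]; apply/latE; rewrite qintM.
  (* Read off from [omega * a = - g a + a theta] and [omega * theta = c a + (g + 1) theta], where
     [theta = g + omega]. *)
  exists (u * x - v * g * x + v * c * y), (u * y + v * (x * a + y * g) + v * y).
  by congr qint; rewrite ?acE; ring.
Qed.

Lemma lattice_opp (a b : int) : lattice (- a) b = lattice a b.
Proof.
by apply/seteqP; split=> z /= [x [y ->]]; exists (- x), y; congr (_ + _);
  rewrite !rmorphN /=; ring.
Qed.

Lemma lattice_shift (a b q : int) : lattice a (b - 2 * a * q) = lattice a b.
Proof.
apply/seteqP; split=> z /= [x [y ->]].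
  by exists (x - y * q), y; rewrite /theta; field.
by exists (x + y * q), y; rewrite /theta; field.
Qed.

(** As [theta b * theta (- b) = a c], multiplication by [theta (- b)] sends the generators [a],
    [theta b] to [a] times [theta (- b)], [c]. *)
Lemma lattice_swap (a b c : int) : a != 0 -> b ^+ 2 + 4 * a * c = d ->
  ideal_equiv OK (lattice a b) (lattice c (- b)).
Proof.
move=> a0 bd; have [g bE] := odd_middle _ _ _ bd.
have d2 : delta ^+ 2 = b%:~R ^+ 2 + 4 * a%:~R * c%:~R.
  by rewrite delta2 -bd rmorphD rmorphXn !rmorphM.
have thetaN : theta (- b) = qint (- g - 1) 1 by rewrite bE -thetaE; congr theta; ring.
have aE : a%:~R = qint a 0 by rewrite /qint mul0r addr0.
apply: (@ideal_equivP _ _ (theta (- b)) a%:~R).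
- by rewrite thetaN; apply: OK_qint.
- by rewrite aE; apply: OK_qint.
- by apply/eqP; rewrite thetaN => /qint_eq0[_ /eqP]; rewrite oner_eq0.
- by rewrite intr_eq0.
- move=> _ [x [y ->]]; exists (y%:~R * c%:~R + x%:~R * theta (- b)).
    by exists y, x.
  by rewrite /theta; field: d2.
- move=> _ [x [y ->]]; exists (y%:~R * a%:~R + x%:~R * theta b).
    by exists y, x.
  by rewrite /theta; field: d2.
Qed.

Definition form_ideal (w : int * int * int) : set algC := lattice w.1.1 w.1.2.

Lemma form_ideal_nonzero w : simple d w -> nonzero_ideals OK (form_ideal w).
Proof.
case: w => [[a b] c] /simpleP[a0 _ bd].
by apply: (lattice_ideal _ _ _ _ bd); rewrite gt_eqF.
Qed.

Lemma form_ideal_swap w : simple d w -> ideal_equiv OK (form_ideal w) (form_ideal (swap w)).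
Proof.
case: w => [[a b] c] /simpleP[a0 _ bd].
by apply: (lattice_swap _ _ _ _ bd); rewrite gt_eqF.
Qed.

(** The matrix gives a new basis [gam], [del] of the same lattice. Multiplication by the conjugate
    [gam'] of [gam] sends it to [a * A2], [a * T2]. *)
Lemma form_ideal_act w (p q s t : int) : simple d w -> simple d (act p q s t w) ->
  p * t - q * s = 1 -> ideal_equiv OK (form_ideal w) (form_ideal (act p q s t w)).
Proof.
case: w => [[a b] c] /simpleP[a0 c0 bd] act_simple D.
have d2 : delta ^+ 2 = b%:~R ^+ 2 + 4 * a%:~R * c%:~R.
  by rewrite delta2 -bd rmorphD rmorphXn !rmorphM.
have [g bE] := odd_middle _ _ _ bd.
have [A0 _ _] := simpleP _ _ _ _ act_simple.
have DC : p%:~R * t%:~R = 1 + q%:~R * s%:~R :> algC.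
  have e : p * t = 1 + q * s by move: D; clear; lia.
  by rewrite -!rmorphM /= e rmorphD.
pose gam := p%:~R * a%:~R + q%:~R * theta b.
pose gam' := p%:~R * a%:~R - q%:~R * theta (- b).
pose del := s%:~R * a%:~R + t%:~R * theta b.
have gamE : gam' = qint (p * a + q * (g + 1)) (- q).
  by rewrite /gam' bE /theta /qint; field.
pose A2 : algC := (a * p ^+ 2 + b * p * q - c * q ^+ 2)%:~R.
pose T2 := theta (2 * a * p * s + b * (p * t + q * s) - 2 * c * q * t).
have e1 : a%:~R * A2 = gam' * gam.
  rewrite /A2 /gam' /gam /theta !(rmorphD, rmorphB, rmorphM, rmorphXn, rmorphN) /=.
  by field: d2.
have e2 : a%:~R * T2 = gam' * del.
  rewrite /T2 /gam' /del /theta !(rmorphD, rmorphB, rmorphM, rmorphXn, rmorphN) /=.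
  by field: d2 DC.
apply: (@ideal_equivP _ _ gam' a%:~R).
- by rewrite gamE; apply: OK_qint.
- have -> : a%:~R = qint a 0 by rewrite /qint mul0r addr0.
  exact: OK_qint.
- apply/eqP => gam0; move/eqP: e1; rewrite gam0 mul0r -rmorphM intr_eq0 mulf_eq0.
  by rewrite !gt_eqF.
- by rewrite intr_eq0 gt_eqF.
- move=> _ [x [y ->]].
  exists ((x * t - y * s)%:~R * A2 + (y * p - x * q)%:~R * T2).
    by exists (x * t - y * s), (y * p - x * q).
  transitivity (gam' * ((x * t - y * s)%:~R * gam + (y * p - x * q)%:~R * del)).
    by congr (gam' * _); rewrite /gam /del; ring: DC.
  by rewrite mulrDr mulrCA -e1 [gam' * (_ * del)]mulrCA -e2; ring.
- move=> _ [x [y ->]].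
  exists ((x * p + y * s)%:~R * a%:~R + (x * q + y * t)%:~R * theta b).
    by exists (x * p + y * s), (x * q + y * t).
  transitivity (gam' * (x%:~R * gam + y%:~R * del)).
    by congr (gam' * _); rewrite /gam /del; ring.
  by rewrite /form_ideal /= -/A2 -/T2 mulrDr mulrCA -e1 [gam' * (_ * del)]mulrCA -e2; ring.
Qed.

(** * From equivalent ideals to equivalent forms *)

Lemma delta_components (L1 L2 M1 M2 x y x' y' : int) :
  (M1%:~R + M2%:~R * delta) * (x%:~R + y%:~R * delta)
    = (L1%:~R + L2%:~R * delta) * (x'%:~R + y'%:~R * delta) ->
  M1 * x + M2 * y * d = L1 * x' + L2 * y' * d /\ M1 * y + M2 * x = L1 * y' + L2 * x'.
Proof.
move=> e; have d2 : delta ^+ 2 = d%:~R := delta2.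
have [|e1 e2] := delta_irrational_int
  (M1 * x + M2 * y * d - (L1 * x' + L2 * y' * d)) (M1 * y + M2 * x - (L1 * y' + L2 * x')).
  transitivity ((M1%:~R + M2%:~R * delta) * (x%:~R + y%:~R * delta)
    - (L1%:~R + L2%:~R * delta) * (x'%:~R + y'%:~R * delta)); last by rewrite e subrr.
  by ring: d2.
by split; apply/eqP; rewrite -subr_eq0; apply/eqP.
Qed.

Lemma norm_eq0 (L1 L2 : int) : L1 ^+ 2 - L2 ^+ 2 * d = 0 -> L1 = 0 /\ L2 = 0.
Proof.
move=> e.
have /eqP : (L1%:~R + L2%:~R * delta) * (L1%:~R + (- L2)%:~R * delta) = 0.
  have d2 : delta ^+ 2 = d%:~R := delta2.
  transitivity ((L1 ^+ 2 - L2 ^+ 2 * d)%:~R : algC); last by rewrite e.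
  by ring: d2.
rewrite mulf_eq0 => /orP[] /eqP /(delta_irrational_int) [-> //].
by move=> /eqP; rewrite oppr_eq0 => /eqP ->.
Qed.

(** With [L], [M] the components of [2 lam], [2 mu], the four equations say
    [mu * a2 = lam * (p a + q theta b)] and [mu * theta b2 = lam * (s a + t theta b)]. A form is the
    norm on its lattice divided by [a]; [key], which compares oriented covolumes, supplies the
    scaling factor. *)
Lemma form_transform (a b c a2 b2 c2 L1 L2 M1 M2 p q s t : int) :
    b ^+ 2 + 4 * a * c = d -> b2 ^+ 2 + 4 * a2 * c2 = d ->
    a != 0 -> a2 != 0 -> L1 ^+ 2 - L2 ^+ 2 * d != 0 ->
    2 * a2 * M1 = L1 * (2 * p * a + q * b) + L2 * q * d ->
    2 * a2 * M2 = L1 * q + L2 * (2 * p * a + q * b) ->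
    M1 * b2 + M2 * d = L1 * (2 * s * a + t * b) + L2 * t * d ->
    M1 + M2 * b2 = L1 * t + L2 * (2 * s * a + t * b) ->
  act p q s t (a, b, c)
    = ((p * t - q * s) * a2, (p * t - q * s) * b2, (p * t - q * s) * c2).
Proof.
move=> bd b2d a0 a20 NL0 e1 e2 e3 e4; rewrite /act; set D := p * t - q * s.
set NL := L1 ^+ 2 - L2 ^+ 2 * d in NL0; set NM := M1 ^+ 2 - M2 ^+ 2 * d.
have key : a2 * NM = D * a * NL.
  apply: (mulfI (x := 2)) => //.
  transitivity ((2 * a2 * M1) * (M1 + M2 * b2) - (M1 * b2 + M2 * d) * (2 * a2 * M2)).
    by rewrite /NM; ring.
  by rewrite e1 e2 e3 e4 /NL /D; ring.
have aNL : a * NL != 0 by rewrite mulf_neq0.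
congr (_, _, _).
- apply: (mulfI (x := 4 * (a * NL))); first by rewrite mulf_neq0.
  transitivity (4 * a2 * (a2 * NM)); last by rewrite key; ring.
  transitivity ((2 * a2 * M1) ^+ 2 - (2 * a2 * M2) ^+ 2 * d); last by rewrite /NM; ring.
  by rewrite e1 e2 /NL -bd; ring.
- apply: (mulfI (x := 2 * (a * NL))); first by rewrite mulf_neq0.
  transitivity (2 * b2 * (a2 * NM)); last by rewrite key; ring.
  transitivity ((2 * a2 * M1) * (M1 * b2 + M2 * d) - (2 * a2 * M2) * (M1 + M2 * b2) * d).
    by rewrite e1 e2 e3 e4 /NL -bd; ring.
  by rewrite /NM; ring.
- apply: (mulfI (x := 4 * (a * NL))); first by rewrite mulf_neq0.
  transitivity (4 * c2 * (a2 * NM)); last by rewrite key; ring.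
  transitivity ((M1 + M2 * b2) ^+ 2 * d - (M1 * b2 + M2 * d) ^+ 2).
    by rewrite e3 e4 /NL -bd; ring.
  by rewrite /NM -b2d; ring.
Qed.

(** Expressing the generators of each lattice through the other gives mutually inverse integer
    matrices, so the determinant is 1 or -1. *)
Lemma form_ideal_equiv w w2 : simple d w -> simple d w2 ->
  ideal_equiv OK (form_ideal w) (form_ideal w2) -> equivalent w w2.
Proof.
case: w => [[a b] c]; case: w2 => [[a2 b2] c2].
move=> /simpleP[a_gt0 _ bd] /simpleP[a2_gt0 _ b2d].
have a0 : a != 0 by rewrite gt_eqF.
have a20 : a2 != 0 by rewrite gt_eqF.
move=> [lam [mu [/OKP[u [v lamE]] /OKP[u' [v' muE]] lam0 mu0 e]]].
rewrite /form_ideal /= in e.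
have lat10 a' b' : lattice a' b' a'%:~R by exists 1, 0; rewrite mul0r addr0 mul1r.
have lat01 a' b' : lattice a' b' (theta b') by exists 0, 1; rewrite mul0r add0r mul1r.
have [_ [p [q ->]] e1] : [set lam * x | x in lattice a b] (mu * a2%:~R).
  by rewrite e; exists a2%:~R.
have [_ [s [t ->]] e2] : [set lam * x | x in lattice a b] (mu * theta b2).
  by rewrite e; exists (theta b2).
have [_ [p' [q' ->]] e3] : [set mu * x | x in lattice a2 b2] (lam * a%:~R).
  by rewrite -e; exists a%:~R.
have [_ [s' [t' ->]] e4] : [set mu * x | x in lattice a2 b2] (lam * theta b).
  by rewrite -e; exists (theta b).
have [i1 i2] : p' * p + q' * s = 1 /\ p' * q + q' * t = 0.
  apply: (lattice_comb_inj a b) => //; apply: (mulfI lam0).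
  transitivity (p'%:~R * (lam * (p%:~R * a%:~R + q%:~R * theta b))
     + q'%:~R * (lam * (s%:~R * a%:~R + t%:~R * theta b))); first by ring.
  by rewrite e1 e2 mul0r addr0 mul1r -e3; ring.
have [i3 i4] : s' * p + t' * s = 0 /\ s' * q + t' * t = 1.
  apply: (lattice_comb_inj a b) => //; apply: (mulfI lam0).
  transitivity (s'%:~R * (lam * (p%:~R * a%:~R + q%:~R * theta b))
     + t'%:~R * (lam * (s%:~R * a%:~R + t%:~R * theta b))); first by ring.
  by rewrite e1 e2 mul0r add0r mul1r -e4; ring.
have D1 : (p * t - q * s) * (p' * t' - q' * s') = 1.
  transitivity ((p' * p + q' * s) * (s' * q + t' * t) - (p' * q + q' * t) * (s' * p + t' * s)).
    by ring.
  by rewrite i1 i2 i3 i4.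
have lam2 : 2 * lam = (2 * u + v)%:~R + v%:~R * delta by rewrite lamE /qint; field.
have mu2 : 2 * mu = (2 * u' + v')%:~R + v'%:~R * delta by rewrite muE /qint; field.
have [|f1 f2] := delta_components (2 * u + v) v (2 * u' + v') v' (2 * a2) 0 (2 * p * a + q * b) q.
  rewrite -lam2 -mu2 mul0r addr0.
  transitivity (4 * (mu * a2%:~R)); first by ring.
  by rewrite -e1 /theta; field.
have [|f3 f4] := delta_components (2 * u + v) v (2 * u' + v') v' b2 1 (2 * s * a + t * b) t.
  rewrite -lam2 -mu2.
  transitivity (4 * (mu * theta b2)); first by rewrite /theta; field.
  by rewrite -e2 /theta; field.
have NL0 : (2 * u + v) ^+ 2 - v ^+ 2 * d != 0.
  apply/eqP => /norm_eq0[n1 n2]; move/eqP: lam0; apply; rewrite lamE /qint n2.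
  have -> : u = 0 by move: n1 n2; clear; lia.
  by rewrite mul0r addr0.
have := form_transform a b c a2 b2 c2 (2 * u + v) v (2 * u' + v') v' p q s t bd b2d a0 a20 NL0.
rewrite -{}f1 -{}f2 -{}f3 -{}f4 !mulr0 !mulr1 mul0r addr0 add0r.
rewrite ![2 * a2 * _]mulrC => /(_ erefl erefl erefl erefl).
move=> actE; have [DE|DE] := unit_det _ _ D1; rewrite DE in actE.
  by exists p, q, s, t; split=> //; left; rewrite actE !mul1r.
exists s, t, p, q; split; first by move: DE; clear; lia.
move: actE; rewrite /act => -[A B C].
right; rewrite /act /swap; congr (_, _, _).
- by move: C; clear; lia.
- by move: B; clear; lia.
- by move: A; clear; lia.
Qed.

(** Passing through [equivalent] avoids conjugating ideals: on matrices, [flip] merely negates the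
    off-diagonal entries. *)
Lemma form_ideal_flip w w2 : simple d w -> simple d w2 ->
  ideal_equiv OK (form_ideal w) (form_ideal w2) ->
  ideal_equiv OK (form_ideal (flip w)) (form_ideal (flip w2)).
Proof.
move=> w_s w2_s /(form_ideal_equiv _ _ w_s w2_s)/equivalent_flip[p [q [s [t [D H]]]]].
have wf_s := flip_simple _ _ w_s; have w2f_s := flip_simple _ _ w2_s.
case: H => H.
  by rewrite -H; apply: form_ideal_act; rewrite // H.
apply: ideal_equiv_trans (ideal_equiv_sym _ _ (form_ideal_swap _ w2f_s)).
by rewrite -H; apply: form_ideal_act; rewrite // H swap_simple.
Qed.

Lemma form_ideal_step w : simple d w ->
  ideal_equiv OK (form_ideal w) (form_ideal (step w)).
Proof.
move=> w_s; have [p [q [s [t [D sE]]]]] : exists p q s t : int,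
    p * t - q * s = 1 /\ act p q s t w = step w.
  case: w {w_s} => [[a b] c]; rewrite /step; case: ifP => _.
    by exists 1, 0, (- 1), 1; split=> //; rewrite /act; congr (_, _, _); ring.
  by exists 1, (- 1), 0, 1; split=> //; rewrite /act; congr (_, _, _); ring.
by rewrite -sE; apply: form_ideal_act; rewrite // sE; apply: step_simple.
Qed.

(** After a shift, [|b| <= a]. If then [c < 0], [4 a |c| = b^2 - d < a^2], so exchanging [a] and
    [- c] lowers [a]; [c = 0] would make [d] a square. *)
Lemma lattice_reduce (a b c : int) : 0 < a -> b ^+ 2 + 4 * a * c = d ->
  exists2 w, simple d w & ideal_equiv OK (lattice a b) (form_ideal w).
Proof.
have [n] := ubnP `|a|%N; elim: n a b c => // n IH a b c an a_gt0 bd.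
have a0 : a != 0 by rewrite gt_eqF.
have [q qb] : exists q : int, `|b - 2 * a * q| <= a.
  exists ((b + a) %/ (2 * a))%Z.
  have := divz_eq (b + a) (2 * a); have := modz_ge0 (b + a) (_ : 2 * a != 0).
  have := ltz_mod (b + a) (_ : 2 * a != 0).
  set m := modz _ _; set e := divz _ _ => h1 h2 h3.
  have a20 : 2 * a != 0 by rewrite mulf_neq0.
  move: (h1 a20) (h2 a20) h3 a_gt0; clear; rewrite [e * _]mulrC; lia.
rewrite -(lattice_shift a b q).
set b' := b - 2 * a * q in qb *; set c' := c + b * q - a * q ^+ 2.
have b'd : b' ^+ 2 + 4 * a * c' = d by rewrite -bd /b' /c'; ring.
clearbody b' c'.
have [c'_gt0|c'_lt0|c'0] := ltrgtP 0 c'.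
- by exists (a, b', c'); [apply/simpleP | apply: ideal_equiv_refl].
- have cd : (- b') ^+ 2 + 4 * (- c') * (- a) = d by rewrite -b'd; ring.
  have lt_ca : - c' < a.
    have : 0 <= (a - b') * (a + b') by apply: mulr_ge0; move: qb; clear; lia.
    rewrite -subr_sqr subr_ge0 => b'a.
    have : a * (4 * - c') < a * a by move: b'a b'd d_gt0; clear; lia.
    by rewrite ltr_pM2l //; move: a_gt0 c'_lt0; clear; lia.
  have [||w w_s h] := IH (- c') (- b') (- a) _ _ cd.
  + by move: an lt_ca c'_lt0; clear; lia.
  + by rewrite oppr_gt0.
  exists w => //; apply: ideal_equiv_trans h.
  rewrite lattice_opp; exact: (lattice_swap _ _ _ a0 b'd).
- by have /eqP[] := nsq b'; rewrite -b'd -c'0 mulr0 addr0.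
Qed.

(** Hermite normal form. Closure under multiplication by omega makes [v0] divide [a0] and [u0], so
    [J] is [v0] times a lattice to be reduced. *)
Lemma ideal_form (J : set algC) : nonzero_ideals OK J ->
  exists2 w, simple d w & ideal_equiv OK J (form_ideal w).
Proof.
move=> [[JO J0 JD JM] [x Jx x0]].
have JB u v u' v' m : J (qint u v) -> J (qint u' v') -> J (qint (u - m * u') (v - m * v')).
  move=> h1 h2; have := JD _ _ h1 (JM _ _ (OK_qint (- m) 0) h2).
  by rewrite qintM qintD; congr (J (qint _ _)); ring.
have JW u v : J (qint u v) -> J (qint (k * v) (u + v)).
  by move=> /(JM _ _ (OK_qint 0 1)); rewrite qintM; congr (J (qint _ _)); ring.
have [u [v xE]] : exists u v, x = qint u v by apply/OKP/JO.
(* The norm of [x], a nonzero integer in [J]. *)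
pose N := u ^+ 2 + u * v - k * v ^+ 2.
have JN : J (qint N 0).
  have := JM _ _ (OK_qint (u + v) (- v)) Jx.
  by rewrite xE qintM; congr (J (qint _ _)); rewrite /N; ring.
have N0 : N != 0.
  apply/eqP => N0; have := norm_eq0 (2 * u + v) v.
  have -> : (2 * u + v) ^+ 2 - v ^+ 2 * d = 4 * N by rewrite /N dE; ring.
  rewrite N0 mulr0 => /(_ erefl)[n1 n2]; move/eqP: x0; apply; rewrite xE n2.
  have -> : u = 0 by move: n1 n2; clear; lia.
  by rewrite /qint mul0r addr0.
have J00 : J (qint 0 0) by rewrite /qint mul0r addr0.
have Jabs : J (qint `|N| 0).
  case: (ger0P N) => // _.
  by have := JB _ _ _ _ 1 J00 JN; congr (J (qint _ _)); ring.
have exA : exists n : nat, (0 < n)%N && `[< J (qint n 0) >].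
  by exists `|N|%N; rewrite absz_gt0 N0; apply/asboolP; rewrite abszE.
have exV : exists n : nat, (0 < n)%N && `[< exists u, J (qint u n) >].
  exists `|N|%N; rewrite absz_gt0 N0; apply/asboolP; exists 0.
  by rewrite abszE; have := JW _ _ Jabs; congr (J (qint _ _)); ring.
case: (ex_minnP exA) => a0 /andP[a0_gt0 /asboolP Ja0] a0_min.
case: (ex_minnP exV) => v0 /andP[v0_gt0 /asboolP[u0 Ju0]] v0_min.
have dvd_v0 (u' v' : int) : J (qint u' v') -> (v0 %| v')%Z.
  move=> Jv; apply/dvdz_mod0P; apply: contrapT => /eqP r0.
  have v00 : v0%:Z != 0 by rewrite -lt0n.
  have r_gt0 : (0 < `|(v' %% v0)%Z|)%N by rewrite absz_gt0.
  have lt_r : (`|(v' %% v0)%Z| < v0)%N.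
    by rewrite -ltz_nat abszE ger0_norm ?modz_ge0 // ltz_pmod.
  suff h : (0 < `|(v' %% v0)%Z|)%N && `[< exists u, J (qint u `|(v' %% v0)%Z|%N) >].
    by have := v0_min _ h; rewrite leqNgt lt_r.
  rewrite r_gt0; apply/asboolP; rewrite abszE ger0_norm ?modz_ge0 //.
  exists (u' - (v' %/ v0)%Z * u0); have := JB _ _ _ _ (v' %/ v0)%Z Jv Ju0.
  by congr (J (qint _ _)); rewrite {1}(divz_eq v' v0); ring.
have dvd_a0 (u' : int) : J (qint u' 0) -> (a0 %| u')%Z.
  move=> Ju; apply/dvdz_mod0P; apply: contrapT => /eqP r0.
  have a00 : a0%:Z != 0 by rewrite -lt0n.
  have r_gt0 : (0 < `|(u' %% a0)%Z|)%N by rewrite absz_gt0.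
  have lt_r : (`|(u' %% a0)%Z| < a0)%N.
    by rewrite -ltz_nat abszE ger0_norm ?modz_ge0 // ltz_pmod.
  suff h : (0 < `|(u' %% a0)%Z|)%N && `[< J (qint `|(u' %% a0)%Z|%N 0) >].
    by have := a0_min _ h; rewrite leqNgt lt_r.
  rewrite r_gt0; apply/asboolP; rewrite abszE ger0_norm ?modz_ge0 //.
  have := JB _ _ _ _ (u' %/ a0)%Z Ju Ja0; rewrite mulr0 subr0.
  by congr (J (qint _ _)); rewrite {1}(divz_eq u' a0); ring.
have /dvdzP[a a0E] : (v0 %| a0%:Z)%Z.
  by have := dvd_v0 _ _ (JW _ _ Ja0); rewrite addr0.
have /dvdzP[g u0E] : (v0 %| u0)%Z.
  by have := dvd_v0 _ _ (JB _ _ _ _ 1 (JW _ _ Ju0) Ju0); rewrite mul1r addrK.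
have v0z : v0%:Z != 0 by rewrite -lt0n.
have a_gt0 : 0 < a by rewrite -(pmulr_lgt0 _ (_ : 0 < v0%:Z)) // -a0E.
(* omega times [v0 (g + omega)], minus [g + 1] times it, is the integer [(k - g^2 - g) v0] of [J],
   hence a multiple of [a0 = a v0]. *)
have /dvdzP[c cE] : (a %| k - g ^+ 2 - g)%Z.
  have := JB _ _ _ _ (g + 1) (JW _ _ Ju0) Ju0.
  rewrite (_ : u0 + v0 - (g + 1) * v0 = 0); last by rewrite u0E; ring.
  move/dvd_a0; rewrite a0E u0E.
  rewrite (_ : _ - _ = (k - g ^+ 2 - g) * v0); last by ring.
  by rewrite dvdz_mul2r // => /orP[/eqP e|//]; rewrite e eqxx in v0z.
have bd : (2 * g + 1) ^+ 2 + 4 * a * c = d.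
  by rewrite dE; move: cE; clear; lia.
have [w w_s h] := lattice_reduce _ _ _ a_gt0 bd.
exists w => //; apply: ideal_equiv_trans h.
apply: (@ideal_equivP _ _ (qint 1 0) (qint v0 0)); try exact: OK_qint.
- by apply/eqP => /qint_eq0[/eqP]; rewrite oner_eq0.
- by apply/eqP => /qint_eq0[/eqP]; rewrite (negbTE v0z).
- move=> z Jz; have [u' [v' zE]] : exists u v, z = qint u v by apply/OKP/JO.
  rewrite zE in Jz *; have /dvdzP[y yE] := dvd_v0 _ _ Jz.
  have := JB _ _ _ _ y Jz Ju0.
  rewrite (_ : v' - y * v0 = 0); last by rewrite yE subrr.
  move=> /dvd_a0/dvdzP[x' xE'].
  exists (qint (x' * a + y * g) y).
    by exists x', y; rewrite thetaE /qint; field.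
  rewrite !qintM; congr qint; last by rewrite yE; ring.
  have -> : u' = x' * a0 + y * u0 by rewrite -xE'; ring.
  by rewrite a0E u0E; ring.
- move=> _ [x' [y ->]]; exists (qint (x' * a0 + y * u0) (y * v0)).
    have := JB _ _ _ _ (- x') (JB _ _ _ _ (- y) J00 Ju0) Ja0.
    by congr (J (qint _ _)); ring.
  rewrite thetaE a0E u0E; transitivity (qint v0 0 * qint (x' * a + y * g) y).
    by rewrite !qintM; congr qint; ring.
  by congr (_ * _); rewrite /qint; field.
Qed.


(** * Counting ideal classes by forms *)

Definition form_class (w : int * int * int) : set (set algC) := ideal_class OK (form_ideal w).

Lemma ideal_class_eq I J : nonzero_ideals OK J ->
  ideal_equiv OK I J <-> ideal_class OK I = ideal_class OK J.
Proof.
move=> J0; split=> [IJ|e].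
  apply/seteqP; split=> K [K0 h]; split=> //; last exact: ideal_equiv_trans h.
  exact: ideal_equiv_trans (ideal_equiv_sym _ _ IJ) h.
have : ideal_class OK J J by split=> //; apply: ideal_equiv_refl.
by rewrite -e => -[].
Qed.

Lemma form_class_eq w w2 : simple d w2 ->
  ideal_equiv OK (form_ideal w) (form_ideal w2) <-> form_class w = form_class w2.
Proof. by move=> s; apply: ideal_class_eq; apply: form_ideal_nonzero. Qed.

Lemma form_class_flip w w2 : simple d w -> simple d w2 ->
  form_class w = form_class w2 -> form_class (flip w) = form_class (flip w2).
Proof.
move=> ws w2s /form_class_eq => /(_ w2s) h; apply/form_class_eq; first exact: flip_simple.
exact: form_ideal_flip.
Qed.

Lemma form_class_orbit w0 K w : simple d w0 -> w \in orbit_seq w0 K ->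
  form_class w = form_class w0.
Proof.
move=> w0s.
have cyc x : x \in traject step w0 K -> simple d x /\ form_class x = form_class w0.
  move=> /trajectP[m _ ->]; elim: m => [//|m [ms mE]]; split; first exact: step_simple.
  rewrite -mE; apply/esym/form_class_eq; first exact: step_simple.
  exact: form_ideal_step.
rewrite mem_cat => /orP[/cyc[] //|/mapP[x /cyc[xs <-] ->]].
by apply/esym/form_class_eq; [exact: swap_simple | apply: form_ideal_swap].
Qed.

Lemma form_class_mem w0 m w : simple d w0 -> iter m step (step w0) = w0 ->
  simple d w -> form_class w = form_class w0 -> w \in orbit_seq w0 m.+1.
Proof.
move=> w0s per ws /esym/form_class_eq => /(_ ws) h.
by apply: (equivalent_mem_orbit d) => //; apply: form_ideal_equiv.
Qed.

(** This also yields finiteness of the set of classes, without which [fset_set] would be empty. *)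
Lemma ideal_classes_forms :
  ideal_classes OK = [set` [seq form_class w | w <- forms d]]%classic.
Proof.
apply/seteqP; split=> C /=.
  move=> [J J0 <-]; have [w ws Jw] := ideal_form J J0.
  apply/mapP; exists w; first by rewrite mem_forms.
  by apply/ideal_class_eq => //; apply: form_ideal_nonzero.
move=> /mapP[w]; rewrite mem_forms // => ws ->.
by exists (form_ideal w) => //; apply: form_ideal_nonzero.
Qed.

Lemma class_number_undup : h d = size (undup [seq form_class w | w <- forms d]).
Proof.
rewrite /h /class_number ideal_classes_forms -card_fseq; congr (#|` _ |%fset).
apply/fsetP => C; rewrite in_fset_set; last exact: finite_seq.
by rewrite mem_setE [RHS]in_fset.
Qed.

Lemma class_number_eq (ws : seq (int * int * int)) :
    {in ws, forall w, simple d w} -> uniq [seq form_class w | w <- ws] ->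
    (forall w, simple d w -> form_class w \in [seq form_class w | w <- ws]) ->
  h d = size ws.
Proof.
move=> ws_s ws_u cover; rewrite class_number_undup -(size_map form_class).
apply: perm_size; apply: uniq_perm; rewrite ?undup_uniq // => C.
rewrite mem_undup; apply/mapP/mapP => -[w w_in ->].
  by have /mapP := cover w (etrans (esym (mem_forms d d_gt0 w)) w_in).
by exists w => //; rewrite mem_forms //; apply: ws_s.
Qed.

End Ideals.

(** * The class number *)

Lemma notin_orbit_seq w0 m w : w \notin traject step w0 m -> swap w \notin traject step w0 m ->
  w \notin orbit_seq w0 m.
Proof.
move=> h1 h2; rewrite mem_cat negb_or h1 /=; apply/mapP => -[x x_in wE].
by move/negP: h2; rewrite wE swapK.
Qed.

Section Main.

Variables d k N E r : int.
Hypothesis dE : d = 4 * k + 1.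
Hypothesis d_gt0 : 0 < d.
Hypothesis nsq : forall x : int, x ^+ 2 != d.
Hypothesis sqf : squarefree d.
Hypothesis dN : d = 4 * N ^+ 2 + r.
Hypothesis rE : r = 8 * E - 4 * N + 1.
Hypothesis E3 : 3 <= E.
Hypothesis N1 : 1 <= N.

Notation M := (2 * N - 1).
Notation wO := (1, M, 2 * E).
Notation wP := (2, M, E).

(** [E >= 3] keeps [wO], [wP] and their images under [flip] and [swap] distinct. All have [|b| = M],
    a value that each cycle takes only at its start and, for [wO], at [(1, - M, 2 * E)]; this
    separates the three orbits. *)
Lemma class_number_eq3P (SO SP : rat) :
    chain (inner_or M (2 * E)) (1, 2 * N - 3, 2 * N + 2 * E - 2) wO SO ->
    chain (inner M) (2, 2 * N - 5, 2 * N + E - 3) wP SP ->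
  h d = 3%N <-> sigma_sum d = weight wO + SO + 2 * (weight wP + SP).
Proof.
have stepO : step wO = (1, 2 * N - 3, 2 * N + 2 * E - 2).
  rewrite /step ifT; last by move: E3 N1; clear; lia.
  by congr (_, _, _); ring.
have stepP : step wP = (2, 2 * N - 5, 2 * N + E - 3).
  rewrite /step ifT; last by move: E3 N1; clear; lia.
  by congr (_, _, _); ring.
rewrite -stepO -stepP => -[kO [perO innerO sumO]] [kP [perP innerP sumP]].
have wO_s : simple d wO.
  by apply/simpleP; split; rewrite ?dN ?rE; [| move: E3; clear; lia | ring].
have wP_s : simple d wP.
  by apply/simpleP; split; rewrite ?dN ?rE; [| move: E3; clear; lia | ring].
have wP'_s := flip_simple _ _ wP_s.
pose LO := orbit_seq wO kO.+1; pose LP := orbit_seq wP kP.+1; pose LP' := [seq flip x | x <- LP].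
have notO x : x != wO -> x != (1, - M, 2 * E) -> ~~ inner M x -> x \notin traject step wO kO.+1.
  move=> x1 x2 x3; rewrite inE negb_or x1 /=; apply/negP => /(allP innerO).
  by rewrite /inner_or (negbTE x2) orbF (negbTE x3).
have notP x : x != wP -> ~~ inner M x -> x \notin traject step wP kP.+1.
  by move=> x1 x3; rewrite inE negb_or x1 /=; apply/negP => /(allP innerP); rewrite (negbTE x3).
have uO : uniq LO.
  apply: (orbit_seq_uniq d) => //.
    apply/negP => /(allP innerO); rewrite /inner_or /inner !xpair_eqE /=.
    by move: E3 N1; clear; lia.
  by apply: notO; rewrite /inner ?xpair_eqE /=; move: E3 N1; clear; lia.
have uP : uniq LP.
  apply: (orbit_seq_uniq d) => //.
    by apply/negP => /(allP innerP); rewrite /inner /=; move: E3 N1; clear; lia.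
  by apply: notP; rewrite /inner ?xpair_eqE /=; move: E3 N1; clear; lia.
have PO : wP \notin LO.
  by apply: notin_orbit_seq; apply: notO; rewrite /inner ?xpair_eqE /=; move: E3 N1; clear; lia.
have P'O : flip wP \notin LO.
  by apply: notin_orbit_seq; apply: notO; rewrite /inner ?xpair_eqE /=; move: E3 N1; clear; lia.
have P'P : flip wP \notin LP.
  by apply: notin_orbit_seq; apply: notP; rewrite /inner ?xpair_eqE /=; move: E3 N1; clear; lia.
pose cls := form_class d.
have clsO x : x \in LO -> cls x = cls wO by apply: (form_class_orbit d k).
have clsP x : x \in LP -> cls x = cls wP by apply: (form_class_orbit d k).
have sO x : x \in LO -> simple d x by apply: (orbit_seq_simple d).
have sP x : x \in LP -> simple d x by apply: (orbit_seq_simple d).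
have clsP' x : x \in LP' -> simple d x /\ cls x = cls (flip wP).
  move=> /mapP[y yP ->]; have ys := sP y yP; split; first exact: flip_simple.
  by apply: (form_class_flip d k) => //; apply: clsP.
have memO x : simple d x -> cls x = cls wO -> x \in LO by apply: (form_class_mem d k).
have memP x : simple d x -> cls x = cls wP -> x \in LP by apply: (form_class_mem d k).
have memP' x : simple d x -> cls x = cls (flip wP) -> x \in LP'.
  move=> xs xP; rewrite -[x]flipK map_f //; apply: memP; first exact: flip_simple.
  by rewrite -[wP]flipK; apply: (form_class_flip d k).
have neOP : cls wO != cls wP by apply/eqP => /esym/(memO _ wP_s); apply/negP.
have neOP' : cls wO != cls (flip wP) by apply/eqP => /esym/(memO _ wP'_s); apply/negP.
have nePP' : cls wP != cls (flip wP) by apply/eqP => /esym/(memP _ wP'_s); apply/negP.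
pose ws := [:: wO; wP; flip wP].
have wsE : [seq cls w | w <- ws] = [:: cls wO; cls wP; cls (flip wP)] by [].
have uws : uniq [seq cls w | w <- ws].
  by rewrite wsE !cons_uniq !in_cons !in_nil !orbF negb_or neOP neOP' nePP'.
have sumLO : \sum_(x <- LO) x.1.1%:Q = weight wO + SO by apply: sum_orbit_seq.
have sumLP : \sum_(x <- LP) x.1.1%:Q = weight wP + SP by apply: sum_orbit_seq.
clearbody LO LP.
pose L := LO ++ LP ++ LP'.
have Ls x : x \in L -> simple d x.
  by rewrite !mem_cat => /or3P[/sO|/sP|/clsP'[]].
have memL x : simple d x -> (x \in L) = (cls x \in [seq cls w | w <- ws]).
  move=> xs; rewrite wsE !mem_cat !in_cons in_nil orbF; apply/or3P/or3P => -[].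
  - by move=> /clsO ->; constructor 1.
  - by move=> /clsP ->; constructor 2.
  - by move=> /clsP'[_ ->]; constructor 3.
  - by move=> /eqP/(memO _ xs); constructor 1.
  - by move=> /eqP/(memP _ xs); constructor 2.
  - by move=> /eqP/(memP' _ xs); constructor 3.
have uL : uniq L.
  rewrite !cat_uniq uO uP map_inj_uniq ?uP; last exact: can_inj flipK.
  rewrite andbT /=; apply/andP; split; apply/hasPn => x.
    rewrite mem_cat => /orP[/clsP xE|/clsP'[_ xE]]; apply/negP => /clsO; rewrite xE; apply/eqP; rewrite eq_sym //.
  by move=> /clsP'[_ xE]; apply/negP => /clsP; rewrite xE; apply/eqP; rewrite eq_sym //.
have sumL : \sum_(x <- L) x.1.1%:Q = weight wO + SO + 2 * (weight wP + SP).
  rewrite !big_cat /= big_map sumLO sumLP (eq_bigr (fun x => x.1.1%:Q)) => [|[[a b] c] _ //].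
  by rewrite sumLP; ring.
have subL : {subset L <= forms d} by move=> x /Ls; rewrite mem_forms.
rewrite sigma_sum_forms // -sumL; split=> [h3|sum_eq].
  apply: perm_big; apply: uniq_perm => //; first exact: forms_uniq.
  move=> x; rewrite mem_forms //; apply/idP/idP => [xs|/Ls //].
  (* Three distinct classes among exactly three are all of them. *)
  have sub3 : {subset [seq cls w | w <- ws] <= undup [seq cls w | w <- forms d]}.
    move=> C /mapP[w w_in ->]; rewrite mem_undup map_f // mem_forms //.
    by move: w_in; rewrite !inE => /or3P[] /eqP ->.
  have [|_ e] := uniq_min_size uws sub3.
    by rewrite -(class_number_undup d k) // h3.
  by rewrite memL // e mem_undup map_f // mem_forms.
apply: (class_number_eq d k _ _ _ _ ws) => //.
  by move=> w; rewrite !inE => /or3P[] /eqP ->.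
move=> w w_s; rewrite -memL //; apply: contraT => wL.
have w_in : w \in forms d by rewrite mem_forms.
(* The forms of [L] already account for the whole sum, so the remaining [a], all positive, add up to
   0; yet [w] is one of these forms. *)
move: sum_eq; rewrite (bigID (mem L)) /= -big_filter.
have permL : perm_eq [seq x <- forms d | x \in L] L.
  apply: uniq_perm; rewrite ?filter_uniq ?forms_uniq // => x.
  by rewrite mem_filter andb_idr // => /subL.
rewrite (perm_big _ permL) /=; move/eqP; rewrite -subr_eq0 addrAC subrr add0r => /eqP sum0.
have := sum0; rewrite (big_rem w) //= wL => /eqP.
rewrite gt_eqF // ltr_pwDl //.
  by case: w w_s {wL w_in} => [[a b] c] /simpleP[a0 _ _]; rewrite /= ltr0z.
rewrite big_seq_cond sumr_ge0 // => x /andP[/mem_rem]; rewrite mem_forms //.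
by case: x => [[a b] c] /simpleP[a0 _ _]; rewrite /= ler0z ltW.
Qed.

End Main.

(** * The exceptional values of [d] and the proof of the theorem *)

Section SmallClassNumbers.

Variables d k : int.
Hypothesis dE : d = 4 * k + 1.
Hypothesis d_gt0 : 0 < d.
Hypothesis nsq : forall x : int, x ^+ 2 != d.
Hypothesis sqf : squarefree d.

Lemma class_number_one_orbit w0 m : simple d w0 ->
  all (fun w => w \in orbit_seq w0 m) (forms d) -> h d = 1%N.
Proof.
move=> w0_s cover; apply: (class_number_eq d k _ _ _ _ [:: w0]) => //.
  by move=> w; rewrite inE => /eqP ->.
move=> w; rewrite -mem_forms // => /(allP cover)/(form_class_orbit d k dE d_gt0 nsq sqf) -> //.
by rewrite mem_head.
Qed.

Lemma class_number_two_orbits w1 w2 m1 m2 : simple d w1 -> simple d w2 ->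
    iter m1 step (step w1) = w1 -> w2 \notin orbit_seq w1 m1.+1 ->
    all (fun w => (w \in orbit_seq w1 m1.+1) || (w \in orbit_seq w2 m2)) (forms d) ->
  h d = 2%N.
Proof.
move=> s1 s2 per ne cover; apply: (class_number_eq d k _ _ _ _ [:: w1; w2]) => //.
- by move=> w; rewrite !inE => /orP[] /eqP ->.
- rewrite !map_cons !cons_uniq in_cons !in_nil orbF andbT; apply/eqP => e.
  by move/negP: ne; apply; apply: (form_class_mem d k).
- move=> w; rewrite -mem_forms // => /(allP cover)/orP[] w_in.
    by rewrite (form_class_orbit d k dE d_gt0 nsq sqf w1 m1.+1) // mem_head.
  by rewrite (form_class_orbit d k dE d_gt0 nsq sqf w2 m2) // in_cons mem_head orbT.
Qed.

End SmallClassNumbers.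

(* The primes above 2 are principal for d = 33; for d = 105 they are not, but their
   squares are. *)
Lemma class_number_33 : squarefree 33 -> (forall x : int, x ^+ 2 != 33) -> h 33 = 1%N.
Proof.
move=> sqf nsq.
by apply: (class_number_one_orbit 33 8 _ _ nsq sqf (1, 5, 2) 10); vm_compute.
Qed.

Lemma class_number_105 : squarefree 105 -> (forall x : int, x ^+ 2 != 105) -> h 105 = 2%N.
Proof.
move=> sqf nsq.
(* The cycles have lengths 14 and 12; the first appears as 13 because one step is split off. *)
by apply: (class_number_two_orbits 105 26 _ _ nsq sqf (1, 9, 6) (2, 9, 3) 13 12); vm_compute.
Qed.

(** An odd [n] would give [n^2 = 1] modulo 8, hence [8 | r], against [r | 4 n]. So [n] is even,
    [r = 1] modulo 4, which leaves [r >= 5] or [r <= -3], and the odd [r] divides [N]. *)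
Lemma class_data (n r d : int) :
    0 < n -> (r %| 4 * n)%Z -> d = n ^+ 2 + r -> (d = 1 %[mod 8])%Z -> `|r| != 1 ->
  exists N mu E : int, [/\ n = 2 * N, 1 <= mu, r = 8 * E - 4 * N + 1 &
    (5 <= r /\ N = r * mu) \/ (r <= - 3 /\ N = - r * mu)].
Proof.
move=> n_gt0 /dvdzP[q qE] dE d8 r1.
have [e de] : exists e, d = 8 * e + 1 by exists (d %/ 8)%Z; move: d8; clear; lia.
have [N nN] : exists N, n = 2 * N.
  have [N [nN|nN]] : exists N, n = 2 * N \/ n = 2 * N + 1.
    by exists (n %/ 2)%Z; clear; lia.
    by exists N.
  exfalso.
  have [j jE] : exists j, N * (N + 1) = 2 * j.
    exists (N * (N + 1) %/ 2)%Z.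
    have [i [iE|iE]] : exists i, N = 2 * i \/ N = 2 * i + 1 by exists (N %/ 2)%Z; clear; lia.
      by rewrite iE; clear; lia.
    by rewrite iE; clear; lia.
  have rE : r = 8 * (e - j).
    by move: dE; rewrite nN de; move: jE; clear; lia.
  by move: qE; rewrite rE nN; clear; lia.
have [j jE] : exists j, N * (N - 1) = 2 * j.
  exists (N * (N - 1) %/ 2)%Z.
  have [i [iE|iE]] : exists i, N = 2 * i \/ N = 2 * i + 1 by exists (N %/ 2)%Z; clear; lia.
    by rewrite iE; clear; lia.
  by rewrite iE; clear; lia.
pose E := e - j.
have rE : r = 8 * E - 4 * N + 1.
  by move: dE; rewrite nN de /E; move: jE; clear; lia.
have /dvdzP[m mE] : (r %| N)%Z.
  have co : coprimez r 8.
    (* Bezout coefficients from [r = 8 E + (1 - 4 N)] and [(1 - 4 N) (1 + 4 N) = 1 - 16 N^2]. *)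
    apply/coprimezP; exists (1 + 4 * N, 2 * N ^+ 2 - E * (1 + 4 * N)) => /=.
    by rewrite rE; ring.
  by rewrite -(Gauss_dvdzr _ co); apply/dvdzP; exists q; rewrite -qE nN; clear; lia.
have N_gt0 : 0 < N by move: n_gt0 nN; clear; lia.
have r0 : r != 0 by apply/eqP => r0; move: rE; rewrite r0; clear; lia.
have [r_gt0|r_lt0|/eqP] := ltrgtP 0 r; last by rewrite eq_sym (negbTE r0).
  exists N, m, E; split=> //.
    by move: N_gt0; rewrite mE pmulr_lgt0 //; clear; lia.
  left; split; last by rewrite mulrC.
  by move: rE r1 r_gt0; clear; lia.
exists N, (- m), E; split=> //.
  by move: N_gt0; rewrite mE nmulr_lgt0 //; clear; lia.
right; split; last by rewrite mulrNN mulrC.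
by move: rE r1 r_lt0; clear; lia.
Qed.

Theorem theorem3p5 (n r d : int)
  (n_gt0 : 0 < n) (r_neq0 : r != 0) (r_dvd_4n : (r %| 4 * n)%Z)
  (r_gtNn : - n < r) (r_le_n : r <= n)
  (r_neq1 : `|r| != 1) (r_neq4 : `|r| != 4)
  (d_def : d = n ^+ 2 + r)
  (d_squarefree : squarefree d) (d_mod8 : (d = 1 %[mod 8])%Z) :
  (h d = 3%N ->
     sigma_sum d =
       (2 * n%:Q ^+ 3 * (r%:Q ^+ 2 + 1)
         + n%:Q * (3 * r%:Q ^+ 3 + 170 * r%:Q ^+ 2 + 3 * r%:Q))
       / (8 * r%:Q ^+ 2))
  /\
  (odd (h d) -> d <> 33 ->
     sigma_sum d =
       (2 * n%:Q ^+ 3 * (r%:Q ^+ 2 + 1)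
         + n%:Q * (3 * r%:Q ^+ 3 + 170 * r%:Q ^+ 2 + 3 * r%:Q))
       / (8 * r%:Q ^+ 2) ->
     h d = 3%N).
Proof.
have [N [mu [E [nN mu1 rE rmu]]]] := class_data _ _ _ n_gt0 r_dvd_4n d_def d_mod8 r_neq1.
have dN : d = 4 * N ^+ 2 + r by rewrite d_def nN; ring.
have rN : `|r| <= N.
  case: rmu => -[rb ->].
    by rewrite gtr0_norm ?ler_peMr //; move: rb; clear; lia.
  by rewrite ltr0_norm ?ler_peMr //; move: rb; clear; lia.
have N3 : 3 <= N by move: rN rmu; clear; lia.
have d_gt1 : 1 < d.
  have : 3 * N <= N ^+ 2 by rewrite expr2 ler_pM2r //; move: N3; clear; lia.
  by rewrite dN; move: rN N3; clear; lia.
have d_gt0 : 0 < d by apply: lt_trans d_gt1.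
have nsq (x : int) : x ^+ 2 != d.
  apply/eqP => xd; have := d_squarefree x; rewrite xd dvdzz => /(_ isT) x1.
  by move: d_gt1; rewrite -xd -real_normK ?num_real // x1.
have dk : d = 4 * (2 * (d %/ 8)%Z) + 1 by move: d_mod8; clear; lia.
have [d33|d33] := eqVneq d 33.
  by rewrite d33 in d_squarefree nsq *; rewrite (class_number_33 d_squarefree nsq).
(* The class number 2 is neither 3 nor odd, so both implications hold vacuously. *)
have [d105|d105] := eqVneq d 105.
  by rewrite d105 in d_squarefree nsq *; rewrite (class_number_105 d_squarefree nsq).
(* The bounds fail only for [mu = 1] with [r = 5] or [r = -3], that is, [d = 105] or [d = 33]. *)
have bound : (5 <= r /\ N = r * mu /\ 3 * r + 5 < 4 * N)
    \/ (r <= - 3 /\ N = - r * mu /\ 3 - 3 * r < 4 * N).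
  case: rmu => -[rb NE]; [left | right]; split=> //; split=> //.
    have [mu2|mu2] := leP 2 mu.
      have : r * 2 <= N by rewrite NE ler_pM2l //; move: rb; clear; lia.
      by move: rb; clear; lia.
    have muE : mu = 1 by move: mu1 mu2; clear; lia.
    rewrite muE mulr1 in NE; have [r5|r5] := eqVneq r 5; last by move: rb r5 NE; clear; lia.
    by move: d105; rewrite dN NE r5.
  have [mu2|mu2] := leP 2 mu.
    have : - r * 2 <= N by rewrite NE ler_pM2l //; move: rb; clear; lia.
    by move: rb; clear; lia.
  have muE : mu = 1 by move: mu1 mu2; clear; lia.
  rewrite muE mulr1 in NE; have [r3|r3] := eqVneq r (- 3); last by move: rb r3 NE rE; clear; lia.
  by move: d33; rewrite dN NE r3.
have E3 : 3 <= E.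
  case: bound => -[rb [NE b]]; first by move: rb rE rN; clear; lia.
  have [r3|r3] := eqVneq r (- 3); last by move: rb rE rN r3; clear; lia.
  by rewrite r3 in NE b rE; move: NE b rE; clear; lia.
have [SO [SP [chO chP sumE]]] : exists SO SP, cycle_sums r N E SO SP.
  case: bound => -[rb [NE b]].
    exact: (cycle_sums_pos d r N E nsq dN rE mu).
  exact: (cycle_sums_neg d r N E nsq dN rE mu).
have N1 : 1 <= N by move: N3; clear; lia.
have nQ : n%:Q = 2 * N%:Q by rewrite nN rmorphM.
have iff3 := class_number_eq3P d _ N E r dk d_gt0 nsq d_squarefree dN rE E3 N1 SO SP chO chP.
rewrite nQ -sumE; split; first by move/iff3.
by move=> _ _ /iff3.
Qed.
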